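(* In the setting and under the standing assumptions given in the context, the operator $\mathcal K_H$ is Hilbert--Schmidt, and hence compact, on $X=\bigoplus_{j=1}^{N_{\rm ds}}L^2(\Gamma_j)$. Consequently, $\mathcal S_H=\mathcal I-\mathcal K_H$ is Fredholm of index zero. If the homogeneous global boundary value problem ($\mathcal A u=0$ in $\Omega$, $u=0$ on $\Gamma$) is uniquely solvable, then $\mathcal S_H$ is invertible on $X$.
   Context: Let $\Omega$ be a domain in $\mathbb R^2$ or $\mathbb R^3$ with boundary $\Gamma$, and let $\mathcal A$ be a scalar second-order elliptic partial differential operator with real, possibly variable, coefficients. The global boundary value problem is $\mathcal A u=f$ in $\Omega$, $u=g$ on $\Gamma$. Slab decomposition. $\Omega$ is tessellated into $N_{\rm ds}+1$ consecutive equispaced thin slabs of fixed width $H>0$, separated by internal interfaces $\Gamma_1,\dots,\Gamma_{N_{\rm ds}}$ (in order); distinct interfaces are separated by a positive distance. For $j=1,\dots,N_{\rm ds}$, the double slab $\Psi_j$ is the union of the two neighbouring single slabs that share $\Gamma_j$ (together with $\Gamma_j$). Thus $\Psi_j$ is enclosed between $\Gamma_{j-1}$ and $\Gamma_{j+1}$, its central interface is $\Gamma_j$, and the rest of $\partial\Psi_j$ lies on the physical boundary $\Gamma$. For $j=1$ (resp. $j=N_{\rm ds}$) the interface $\Gamma_{j-1}$ (resp. $\Gamma_{j+1}$) is replaced by a part of $\Gamma$, and there is no corresponding unknown or operator. Solution-transfer operators. Let $G^{(j)}(x,y)$ ($x\in\Psi_j$, $y\in\partial\Psi_j$) be the Poisson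 kernel of $\mathcal A$ in $\Psi_j$, i.e. the solution of $\mathcal A v=0$ in $\Psi_j$, $v=\varphi$ on $\partial\Psi_j$ is $v(x)=\int_{\partial\Psi_j}G^{(j)}(x,y)\varphi(y)\,dy$. Define, for each existing internal interface $\Gamma_{j\pm1}$, $$\mathcal S_{j,j\pm1}:L^2(\Gamma_{j\pm1})\to L^2(\Gamma_j),\qquad [\mathcal S_{j,j\pm1}\varphi](x)=\int_{\Gamma_{j\pm1}}G^{(j)}(x,y)\,\varphi(y)\,dy,\quad x\in\Gamma_j .$$ So $\mathcal S_{j,j\pm 1}\varphi$ is the restriction to $\Gamma_j$ of the solution of the homogeneous Dirichlet problem in $\Psi_j$ with data $\varphi$ on $\Gamma_{j\pm1}$ and zero data on the rest of $\partial\Psi_j$. Equilibrium operator. On $X=\bigoplus_{j=1}^{N_{\rm ds}}L^2(\Gamma_j)$, let $\mathcal K_H$ be the block operator $(\mathcal K_H u)_j=\mathcal S_{j,j-1}u_{j-1}+\mathcal S_{j,j+1}u_{j+1}$ (terms with index $0$ or $N_{\rm ds}+1$ omitted), and let $\mathcal S_H=\mathcal I-\mathcal K_H$. Standing assumptions. $H>0$ is fixed; the global boundary value problem and the local Dirichlet problems on all single slabs and all double slabs are uniquely solvable; and there is sufficient regularity, meaning that the local Dirichlet solution kernels $G^{(j)}(x,y)$ are sufficiently smooth away from the diagonal $x=y$ (in particular they are smooth on the compact products $\Gamma_j\times\Gamma_{j\pm1}$). *)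

(* Defs.v *)
From HB Require Import structures.
From mathcomp Require Import all_boot all_order all_algebra.
From mathcomp Require Import all_classical all_reals all_analysis.

Set Implicit Arguments.
Unset Strict Implicit.
Unset Printing Implicit Defensive.
Import Order.TTheory GRing.Theory Num.Theory.
Import numFieldNormedType.Exports.

Local Open Scope classical_set_scope.
Local Open Scope ring_scope.

(* The norm that the library puts on ['rV[R]_d] is the sup norm; distances and
   diameters below are Euclidean. *)

Section euclidean.
Context (R : realType) (d : nat).
Implicit Types x y : 'rV[R]_d.

Definition dotv x y : R := \sum_(i < d) x 0 i * y 0 i.

Definition edist x y : R := Num.sqrt (dotv (x - y) (x - y)).

Definition diam (A : set 'rV[R]_d) : \bar R :=
  ereal_sup [set (edist p.1 p.2)%:E | p in A `*` A].

Definition boundary (A : set 'rV[R]_d) : set 'rV[R]_d := closure A `\` A°.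

End euclidean.

(* Volume of the unit ball of R^s: 1, 2, pi, 4 pi / 3, ... *)
Fixpoint ball_volume (R : realType) (s : nat) : R :=
  match s with
  | 0 => 1
  | 1 => 2
  | s'.+2 => 2 * pi / s%:R * ball_volume R s'
  end.

Section hausdorff.
Context (R : realType) (d : nat).
Local Notation V := 'rV[R]_d.
Local Open Scope ereal_scope.

(* The value on set0 is imposed: [diam set0 = -oo]. *)
Definition hausdorff_gauge (s : nat) (A : set V) : \bar R :=
  if A == set0 then 0
  else (ball_volume R s / 2 ^+ s)%:E * diam A ^+ s.

Definition small_cover (delta : R) (X : set V) : set (set V)^nat :=
  [set F | (forall k, diam (F k) <= delta%:E) /\ X `<=` \bigcup_k F k].

Definition hausdorff_pre (s : nat) (delta : R) (X : set V) : \bar R :=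
  ereal_inf [set \sum_(k <oo) hausdorff_gauge s (F k) | F in small_cover delta X].

(* Normalized so that H^s coincides with Lebesgue measure on s-dimensional
   affine subspaces, i.e. H^(d-1) is the usual surface measure. *)
Definition hausdorff (s : nat) (X : set V) : \bar R :=
  ereal_sup [set hausdorff_pre s delta X | delta in [set r : R | (0 < r)%R]].

Lemma ball_volume_ge0 s : (0 <= ball_volume R s :> R)%R.
Proof.
suff: ((0 <= ball_volume R s :> R) /\ (0 <= ball_volume R s.+1 :> R))%R by case.
elim: s => [|s [IH1 IH2]] /=; first by rewrite ler01 ler0n.
split=> //; apply: mulr_ge0 => //; apply: mulr_ge0; last by rewrite invr_ge0.
by rewrite mulr_ge0// pi_ge0.
Qed.

Lemma diam_ge0 (A : set V) : A !=set0 -> 0 <= diam A.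
Proof.
case=> x Ax; apply: le_ereal_sup_tmp; exists (edist x x)%:E.
  by exists (x, x).
by rewrite lee_fin sqrtr_ge0.
Qed.

Lemma hausdorff_gauge_ge0 s A : 0 <= hausdorff_gauge s A.
Proof.
rewrite /hausdorff_gauge; case: eqP => // /eqP/set0P A0.
apply: mule_ge0; last exact/expe_ge0/diam_ge0.
by rewrite lee_fin divr_ge0// ball_volume_ge0.
Qed.

Lemma hausdorff_gauge0 s : hausdorff_gauge s set0 = 0.
Proof. by rewrite /hausdorff_gauge eqxx. Qed.

Lemma diam0 : diam (set0 : set V) = -oo.
Proof. by rewrite /diam setX0 image_set0 ereal_sup0. Qed.

Lemma hausdorff_pre_ge0 s delta X : 0 <= hausdorff_pre s delta X.
Proof.
apply: le_ereal_inf_tmp => _ [F _ <-].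
by apply: nneseries_ge0 => n _ _; exact: hausdorff_gauge_ge0.
Qed.

Lemma hausdorff_pre0 s delta : hausdorff_pre s delta set0 = 0.
Proof.
apply/eqP; rewrite eq_le hausdorff_pre_ge0 andbT.
apply: ereal_inf_lbound; exists (fun=> set0).
  by split=> // k; rewrite diam0 leNye.
by apply: eseries0 => n _ _; exact: hausdorff_gauge0.
Qed.

Lemma hausdorff_pre_sigma_subadditive s delta :
  sigma_subadditive (hausdorff_pre s delta).
Proof.
move=> A; have [[i ioo]|] := pselect (exists i, hausdorff_pre s delta (A i) = +oo).
  rewrite (eseries_pinfty _ _ ioo) ?leey// => n _.
  by rewrite -ltNye (lt_le_trans _ (hausdorff_pre_ge0 _ _ _)).
rewrite -forallNE => Aoo.
suff add2e (e : {posnum R}) : hausdorff_pre s delta (\bigcup_n A n) <=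
    \sum_(i <oo) hausdorff_pre s delta (A i) + e%:num%:E.
  by apply/lee_addgt0Pr => _/posnumP[].
rewrite (le_trans _ (epsilon_trick _ _ _))//; last first.
  by move=> n; exact: hausdorff_pre_ge0.
pose P n (B : (set V)^nat) := small_cover delta (A n) B /\
  \sum_(k <oo) hausdorff_gauge s (B k) <=
    hausdorff_pre s delta (A n) + (e%:num / (2 ^ n.+1)%:R)%:E.
have [G PG] : {G : ((set V)^nat)^nat & forall n, P n (G n)}.
  apply: (@choice _ _ P) => n; rewrite /P /hausdorff_pre.
  set S := (X in ereal_inf X); move infS : (ereal_inf S) => iS.
  case: iS infS => [r Sr|Soo|Soo].
  - have en1 : (0 < e%:num / (2 ^ n.+1)%:R)%R by [].
    have /(lb_ereal_inf_adherent en1) : ereal_inf S \is a fin_num by rewrite Sr.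
    move=> [x [B [mB AnB muBx] xS]].
    by exists B; split => //; rewrite muBx -Sr; exact/ltW.
  - by have := Aoo n; rewrite /hausdorff_pre Soo.
  - have := hausdorff_pre_ge0 s delta (A n).
    by rewrite /hausdorff_pre Soo.
pose mu := hausdorff_gauge s.
have muG_ge0 x : 0 <= (mu \o uncurry G) x by exact: hausdorff_gauge_ge0.
apply: (@le_trans _ _ (\esum_(i in setT) (mu \o uncurry G) i)).
  rewrite /hausdorff_pre; apply: ereal_inf_lbound => /=.
  have /card_esym/ppcard_eqP[f] := card_nat2.
  exists (uncurry G \o f).
    split => [i|] /=; first by rewrite /uncurry; case: (f i) => a b; exact: (PG a).1.1.
    apply: (@subset_trans _  (\bigcup_n \bigcup_k G n k)) => [t [i _]|].
      by move=> /((PG i).1.2) -[j _ ?]; exists i => //; exists j.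
    move=> t [i _ [j _ Bijt]]; exists (f^-1%FUN (i, j)) => //=.
    by rewrite invK ?inE.
  rewrite -(esum_pred_image (mu \o uncurry G) _ xpredT) ?[fun=> _]set_true//.
  by rewrite image_eq.
rewrite (_ : esum _ _ = \sum_(i <oo) \sum_(j <oo ) mu (G i j)); last first.
  pose J : nat -> set (nat * nat) := fun i => [set (i, j) | j in setT].
  rewrite (_ : setT = \bigcup_k J k); last first.
    by rewrite predeqE => -[a b]; split => // _; exists a => //; exists b.
  rewrite esum_bigcupT /=; last 2 first.
    - apply/trivIsetP => i j _ _ ij.
      rewrite predeqE => -[n m] /=; split => //= -[] [_] _ [<-{n} _].
      by move=> [m' _] [] /esym/eqP; rewrite (negbTE ij).
    - by move=> /= [n m]; exact: hausdorff_gauge_ge0.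
  rewrite -(image_id [set: nat]) -fun_true esum_pred_image//; last first.
    by move=> n _; apply: esum_ge0 => x _; exact: muG_ge0.
  apply: eq_eseriesr => /= j _.
  rewrite -(esum_pred_image (mu \o uncurry G) (pair j) predT)//=; last first.
    by move=> ? ? _ _; exact: (@can_inj _ _ _ snd).
    by move=> n _; exact: hausdorff_gauge_ge0.
  by congr esum; rewrite predeqE => -[a b]; split; move=> [i _ <-]; exists i.
apply: lee_lim.
- apply: is_cvg_nneseries => n *.
  by apply: nneseries_ge0 => m *; exact: (muG_ge0 (n, m)).
- by apply: is_cvg_nneseries => n *; apply: adde_ge0 => //; exact: hausdorff_pre_ge0.
- by near=> n; apply: lee_sum => i _; exact: (PG i).2.
Unshelve. all: by end_near. Qed.

Lemma hausdorff_pre_le s delta X : (0 < delta)%R ->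
  hausdorff_pre s delta X <= hausdorff s X.
Proof. by move=> d0; apply: ereal_sup_ubound; exists delta. Qed.

Lemma hausdorff_ge0 s X : 0 <= hausdorff s X.
Proof.
by apply: le_trans (hausdorff_pre_le s X ltr01); exact: hausdorff_pre_ge0.
Qed.

Lemma hausdorff0 s : hausdorff s set0 = 0.
Proof.
apply/eqP; rewrite eq_le hausdorff_ge0 andbT.
by apply: ge_ereal_sup => _ [delta _ <-]; rewrite hausdorff_pre0.
Qed.

Lemma le_hausdorff s : {homo hausdorff s : X Y / X `<=` Y >-> X <= Y}.
Proof.
move=> X Y XY; apply: ge_ereal_sup => _ [delta d0 <-].
apply: le_trans (hausdorff_pre_le s Y d0).
apply: ereal_inf_le_tmp => _ [F [sF YF] <-]; exists F => //.
by split=> //; exact: subset_trans YF.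
Qed.

Lemma hausdorff_sigma_subadditive s : sigma_subadditive (hausdorff s).
Proof.
move=> F; apply: ge_ereal_sup => _ [delta d0 <-].
apply: le_trans (hausdorff_pre_sigma_subadditive s delta F) _.
apply: lee_nneseries => n _; first by move=> _; exact: hausdorff_pre_ge0.
exact: hausdorff_pre_le.
Qed.

HB.instance Definition _ s := isOuterMeasure.Build R V (hausdorff s)
  (hausdorff0 s) (hausdorff_ge0 s) (@le_hausdorff s)
  (@hausdorff_sigma_subadditive s).

Definition surface_outer : {outer_measure set V -> \bar R} := @hausdorff d.-1.

(* The (d-1)-dimensional surface measure, on the sigma-algebra of the
   Caratheodory-measurable sets. *)
Definition surface : {measure set (caratheodory_type surface_outer) -> \bar R} :=
  (surface_outer : set (caratheodory_type surface_outer) -> \bar R).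

End hausdorff.

Section elliptic.
Context (R : realType) (d : nat).
Local Notation V := 'rV[R]_d.
Implicit Types (D Om : set V) (f g v w : V -> R).

Record diffop := DiffOp {
  coef2 : V -> 'M[R]_d;
  coef1 : V -> 'rV[R]_d;
  coef0 : V -> R }.

Definition partial (i : 'I_d) v : V -> R := 'D_(delta_mx 0 i) v.

Definition diffop_app (A : diffop) v (x : V) : R :=
  \sum_(i < d) \sum_(j < d) coef2 A x i j * partial j (partial i v) x
  + \sum_(i < d) coef1 A x 0 i * partial i v x
  + coef0 A x * v x.

(* The principal symbol has no nonzero real root; this leaves the sign
   convention (A = Laplacian or A = - Laplacian) free. *)
Definition elliptic (A : diffop) Om := forall x, Om x -> forall xi : V,
  xi != 0 -> \sum_(i < d) \sum_(j < d) coef2 A x i j * xi 0 i * xi 0 j != 0.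

Definition C2_on D v :=
  [/\ forall x, D x -> {for x, continuous v},
      forall i x, D x -> derivable v x (delta_mx 0 i) /\
                         {for x, continuous (partial i v)}
    & forall i j x, D x -> derivable (partial i v) x (delta_mx 0 j) /\
                           {for x, continuous (partial j (partial i v))}].

(* Classical solutions of A v = f in D, v = g on the boundary of D; only the
   values of f on D, of g on the boundary and of v on the closure matter. *)
Definition dirichlet_solution (A : diffop) D f g v :=
  [/\ C2_on D v,
      {within closure D, continuous v},
      forall x, D x -> diffop_app A v x = f x
    & forall x, boundary D x -> v x = g x].

Definition uniquely_solvable (A : diffop) D f g :=
  exists2 v, dirichlet_solution A D f g v
    & forall w, dirichlet_solution A D f g w ->
        forall x, closure D x -> w x = v x.

Definition local_uniquely_solvable (A : diffop) D := forall phi : V -> R,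
  {within boundary D, continuous phi} ->
  uniquely_solvable A D (fun=> 0) phi.

Definition poisson_kernel (A : diffop) D (G : V -> V -> R) :=
  forall phi v : V -> R, {within boundary D, continuous phi} ->
  dirichlet_solution A D (fun=> 0) phi v ->
  forall x, D x ->
    (surface R d).-integrable (boundary D) (fun y => (G x y * phi y)%:E) /\
    v x = \int[surface R d]_(y in boundary D) (G x y * phi y).

Definition continuous_off_diagonal D (G : V -> V -> R) :=
  {within [set p : V * V | [/\ closure D p.1, boundary D p.2 & p.1 <> p.2]],
    continuous (fun p => G p.1 p.2)}.

End elliptic.

Section slabs.
Context (R : realType) (d : nat).
Local Notation V := 'rV[R]_d.

(* Slabs are orthogonal to [axis] and start at height [base] along it; there
   are [nds.+1] of them. *)
Record slabs := Slabs {
  domain : set V;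
  axis : V;
  base : R;
  width : R;
  nds : nat }.

Implicit Types P : slabs.

Definition level P (k : nat) : R := base P + k%:R * width P.

Definition between P (k l : nat) : set V :=
  domain P `&` [set x | level P k < dotv (axis P) x < level P l].

Definition slab_decomposition P :=
  [/\ [/\ open (domain P), connected (domain P) & bounded_set (domain P)],
      dotv (axis P) (axis P) = 1, 0 < width P
    & [set dotv (axis P) x | x in domain P] =
      [set t : R | level P 0 < t < level P (nds P).+1]].

Definition single_slab P (k : nat) : set V := between P k k.+1.

(* Meaningful for 1 <= k <= nds P, and similarly for [interface]; it consists
   of [single_slab P k.-1], [single_slab P k] and the part of [interface P k]
   inside the domain. *)
Definition double_slab P (k : nat) : set V := between P k.-1 k.+1.

Definition interface P (k : nat) : set V :=
  closure (domain P `&` [set x | dotv (axis P) x = level P k]).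

(* A vector of the direct sum of the L^2 spaces of the interfaces is represented
   by a family of functions on R^d, whose component [u i] matters only on the
   interface number [i.+1], and there only up to almost everywhere equality,
   i.e. up to families of norm 0 for [L2_dot]. *)

Local Notation families P := ('I_(nds P) -> V -> R).

Definition L2 (E : set V) (f : V -> R) : Prop :=
  f \_ E \in Lfun (surface R d) 2%:E.

Definition L2_sum P : set (families P) :=
  [set u | forall i : 'I_(nds P), L2 (interface P i.+1) (u i)].

Definition L2_dot P (u v : families P) : R :=
  \sum_(i < nds P) \int[surface R d]_(x in interface P i.+1) (u i x * v i x).

(* S_{j,k} when [G j] is the Poisson kernel of the double slab number j. *)
Definition transfer P (G : nat -> V -> V -> R) (j k : nat)
    (phi : V -> R) : V -> R :=
  fun x => \int[surface R d]_(y in interface P k) (G j x y * phi y).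

(* [u k] lives on the interface k+1 and the value at [i] on the interface i+1:
   the sum has the terms S_{i+1,i} and S_{i+1,i+2} that exist. *)
Definition equilibrium_K P G (u : families P) :
    families P :=
  fun i => \sum_(k < nds P | (k.+1 == i :> nat) || (k == i.+1 :> nat))
             transfer P G i.+1 k.+1 (u k).

Definition equilibrium_S P G (u : families P) :
    families P :=
  u - @equilibrium_K P G u.

End slabs.

Arguments L2_sum {R d} P.
Arguments L2_dot {R d} P u v.
Arguments equilibrium_K {R d} P G u.
Arguments equilibrium_S {R d} P G u.

(* A Hilbert space is given as a subspace [X] of [W] with a semidefinite inner
   product [dot], vectors being identified when their difference has norm 0;
   operators are then well defined on classes since [bounded_operator] asks for
   linearity up to [eqv] and for boundedness. *)

Section hilbert.
Context (R : realType) (W : lmodType R) (X : set W) (dot : W -> W -> R).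
Implicit Types (T : W -> W) (u v w : W).

Definition nrm u : R := Num.sqrt (dot u u).

Definition eqv u v := nrm (u - v) = 0.

Definition bounded_operator T :=
  [/\ forall u, X u -> X (T u),
      forall (a : R) u v, X u -> X v -> eqv (T (a *: u + v)) (a *: T u + T v)
    & exists C : R, forall u, X u -> nrm (T u) <= C * nrm u].

(* The third condition is maximality, which is density of the span when [X] is
   complete. *)
Definition orthonormal_basis (E : set W) :=
  [/\ E `<=` X,
      forall e e', E e -> E e' -> dot e e' = (e == e')%:R
    & forall u, X u -> (forall e, E e -> dot u e = 0) -> nrm u = 0].

Definition hilbert_schmidt T :=
  bounded_operator T /\
  exists2 E, orthonormal_basis E
    & (\esum_(e in E) (nrm (T e) ^+ 2)%:E < +oo)%E.

Definition compact_operator T :=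
  bounded_operator T /\
  forall u : nat -> W, (forall n, X (u n)) ->
    (exists C : R, forall n, nrm (u n) <= C) ->
    exists (s : nat -> nat) (w : W),
      [/\ {homo s : m n / (m < n)%N}, X w
        & nrm (T (u (s n)) - w) @[n --> \oo] --> (0 : R)].

Definition quotient_dim (Y Z : set W) (n : nat) :=
  exists b : 'I_n -> W, (forall i, Y (b i)) /\
    forall u, Y u -> exists! c : 'rV[R]_n, Z (u - \sum_(i < n) c 0 i *: b i).

Definition kernel T : set W := [set u | X u /\ eqv (T u) 0].

Definition range_op T : set W := [set w | exists2 u, X u & eqv w (T u)].

Definition fredholm_index T (k : int) :=
  bounded_operator T /\
  exists n m : nat,
    [/\ quotient_dim (kernel T) [set u | X u /\ eqv u 0] n,
        quotient_dim X (range_op T) m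
      & k = n%:Z - m%:Z].

Definition invertible_operator T :=
  bounded_operator T /\
  exists2 T', bounded_operator T'
    & forall u, X u -> eqv (T (T' u)) u /\ eqv (T' (T u)) u.

End hilbert.

(* Main.v *)
Require Import Defs.
From mathcomp Require Import all_boot all_order all_algebra.
From mathcomp Require Import all_classical all_reals all_analysis.
From mathcomp Require Import measurable_realfun ring lra.

(** The interfaces are compact pieces of parallel hyperplanes, so they have finite
    surface measure ([hausdorff_hyperplane]), and the Poisson kernel of a double
    slab is continuous on the product of its central interface with the two
    interfaces that bound it. For x on an interface, K u at x is therefore the
    inner product of u with a family [kernel_family i x] that is bounded and
    depends continuously on x. With Bessel's inequality this representation
    makes K Hilbert-Schmidt ([kernel_operator_hilbert_schmidt]), and since it
    makes the functions K u equicontinuous it also makes K compact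
    ([kernel_operator_compact]).

    For a compact K on a semi-inner product space, projecting the values of K
    away from finitely many unit vectors leaves an operator B that halves norms,
    and K - B has finite rank. I - B is inverted by iteration, the limit being
    supplied by the compactness of K ([neumann]); what remains is a square
    matrix, whose kernel and cokernel have the same dimension. Hence I - K has
    index zero ([fredholm_compact]), and it is invertible as soon as it is
    injective ([compact_invertible]).

    For the injectivity, let u = K u up to norm zero; replacing u by K u makes it
    continuous on each interface. At a point x of the physical boundary the
    Poisson kernel vanishes at almost all points of a compact part of the
    boundary that avoids x ([poisson_kernel_null]): where the kernel has a sign,
    a bump of positive integral would be the boundary value of a solution that
    stays away from 0 near x. So u vanishes where the interfaces meet the
    physical boundary, and its values on the interfaces that bound a double slab,
    extended by 0, are a continuous Dirichlet datum there. By the equation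
    u = K u, the local solution with this datum equals u on the central
    interface. In a single slab shared by two double slabs the two local
    solutions have the same boundary values, so they coincide ([v_agree]), and
    all of them glue to a solution of the homogeneous global problem
    ([glued_solution]). This solution is 0, and with it u. *)

Set Implicit Arguments.
Unset Strict Implicit.
Unset Printing Implicit Defensive.
Import Order.TTheory GRing.Theory Num.Theory.
Import numFieldNormedType.Exports.

Local Open Scope classical_set_scope.
Local Open Scope ring_scope.

Local Notation edist := Defs.edist.

(** * Semi-inner product spaces *)

(** Bilinearity holds on [X] only, since an integral of products is additive
    only for square-integrable factors; the form is semidefinite, and vectors
    are compared up to norm zero. *)
Record semi_inner (R : realType) (W : lmodType R) (X : set W)
    (dot : W -> W -> R) : Prop := SemiInner {
  sub0 : X 0;
  subL : forall a u v, X u -> X v -> X (a *: u + v);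
  dotsC : forall u v, X u -> X v -> dot u v = dot v u;
  dotsL : forall a u v w, X u -> X v -> X w ->
    dot (a *: u + v) w = a * dot u w + dot v w;
  dots_ge0 : forall u, X u -> 0 <= dot u u }.

Arguments dotsC {R W X dot} _ u v.

Section semi_inner_theory.
Context (R : realType) (W : lmodType R) (X : set W) (dot : W -> W -> R).
Hypothesis XP : semi_inner X dot.
Implicit Types (u v w : W) (a : R).
Local Notation nrm := (nrm dot).

Lemma mem0 : X 0. Proof. exact: sub0 XP. Qed.

Lemma memD u v : X u -> X v -> X (u + v).
Proof. by move=> Xu Xv; rewrite -[u]scale1r; exact: (subL XP). Qed.

Lemma memZ a u : X u -> X (a *: u).
Proof. by move=> Xu; rewrite -[_ *: _]addr0; exact: (subL XP) (sub0 XP). Qed.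

Lemma memN u : X u -> X (- u).
Proof. by move=> Xu; rewrite -scaleN1r; exact: memZ. Qed.

Lemma memB u v : X u -> X v -> X (u - v).
Proof. by move=> Xu Xv; exact/memD/memN. Qed.

Lemma mem_sum (I : Type) (s : seq I) (Q : pred I) (F : I -> W) :
  (forall i, X (F i)) -> X (\sum_(i <- s | Q i) F i).
Proof. by move=> XF; elim/big_rec: _ => [|i u _]; [exact: (sub0 XP)|exact: memD]. Qed.

Hint Resolve mem0 : core.
(* Bilinearity and the triangle inequality ask for membership in [X] at each
   step; these side conditions are closed by the subspace rules. *)
Ltac mem := repeat first [assumption | exact: mem0 | apply: memB | apply: memD
  | apply: memN | apply: memZ | apply: mem_sum => ?
  | match goal with H : forall _, X _ |- _ => exact: H end].
Hint Extern 0 (X _) => (solve [mem]) : core.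

Lemma dotDl u v w : X u -> X v -> X w -> dot (u + v) w = dot u w + dot v w.
Proof. by move=> Xu Xv Xw; rewrite -{1}[u]scale1r (dotsL XP)// mul1r. Qed.

Lemma dot0l w : X w -> dot 0 w = 0.
Proof. by move=> Xw; apply: (addrI (dot 0 w)); rewrite -dotDl// !addr0. Qed.

Lemma dotZl a u w : X u -> X w -> dot (a *: u) w = a * dot u w.
Proof. by move=> Xu Xw; rewrite -[a *: u]addr0 (dotsL XP)// dot0l// addr0. Qed.

Lemma dotDr u v w : X u -> X v -> X w -> dot w (u + v) = dot w u + dot w v.
Proof. by move=> Xu Xv Xw; rewrite (dotsC XP w (u + v))// ?dotDl// ?(dotsC XP w). Qed.

Lemma dotZr a u w : X u -> X w -> dot w (a *: u) = a * dot w u.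
Proof. by move=> Xu Xw; rewrite (dotsC XP w (a *: u))// ?dotZl// ?(dotsC XP w). Qed.

Lemma dotNl u w : X u -> X w -> dot (- u) w = - dot u w.
Proof. by move=> Xu Xw; rewrite -scaleN1r dotZl// mulN1r. Qed.

Lemma dotNr u w : X u -> X w -> dot w (- u) = - dot w u.
Proof. by move=> Xu Xw; rewrite -scaleN1r dotZr// mulN1r. Qed.

Lemma nrm_ge0 u : 0 <= nrm u. Proof. exact: sqrtr_ge0. Qed.
Hint Resolve nrm_ge0 : core.

Lemma sqr_nrm u : X u -> nrm u ^+ 2 = dot u u.
Proof. by move=> Xu; rewrite sqr_sqrtr// (dots_ge0 XP). Qed.

Lemma nrmZ a u : X u -> nrm (a *: u) = `|a| * nrm u.
Proof.
move=> Xu; rewrite /Defs.nrm dotZl// dotZr// mulrA -expr2 sqrtrM ?sqr_ge0//.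
by rewrite sqrtr_sqr.
Qed.

Lemma nrm0 : nrm 0 = 0.
Proof. by rewrite -(scale0r (0 : W)) nrmZ// normr0 mul0r. Qed.

Lemma nrmN u : X u -> nrm (- u) = nrm u.
Proof. by move=> Xu; rewrite -scaleN1r nrmZ// normrN normr1 mul1r. Qed.

Lemma nrmBC u v : X u -> X v -> nrm (u - v) = nrm (v - u).
Proof. by move=> Xu Xv; rewrite -nrmN// opprB. Qed.

Lemma cauchy_schwarz_sqr u v : X u -> X v -> dot u v ^+ 2 <= dot u u * dot v v.
Proof.
move=> Xu Xv.
have E a b : dot (a *: u - b *: v) (a *: u - b *: v) =
    a ^+ 2 * dot u u - 2 * a * b * dot u v + b ^+ 2 * dot v v.
  rewrite !(dotDl, dotDr, dotNl, dotNr, dotZl, dotZr)//=.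
  by rewrite (dotsC XP v u)//; ring.
have P a b := dots_ge0 XP (memB (memZ a Xu) (memZ b Xv)).
have := dots_ge0 XP Xv; rewrite le_eqVlt => /predU1P[v0|v0].
  (* v has norm zero: at u - t v, with this t, the form would be -1 *)
  rewrite -v0 mulr0; have [->|uv0] := eqVneq (dot u v) 0; first by rewrite expr0n.
  have := P 1 ((dot u u + 1) / (2 * dot u v)); rewrite E -v0.
  rewrite (_ : _ + _ = - 1); last by field; rewrite uv0.
  by rewrite oppr_ge0 ler10.
have := P (dot v v) (dot u v); rewrite E.
rewrite (_ : _ + _ = dot v v * (dot u u * dot v v - dot u v ^+ 2)); last by ring.
by rewrite pmulr_rge0// subr_ge0.
Qed.

Lemma cauchy_schwarz u v : X u -> X v -> `|dot u v| <= nrm u * nrm v.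
Proof.
move=> Xu Xv; rewrite -(@ler_pXn2r _ 2)// ?nnegrE// ?mulr_ge0//.
by rewrite exprMn !sqr_nrm// real_normK ?num_real// cauchy_schwarz_sqr.
Qed.

Lemma nrmD u v : X u -> X v -> nrm (u + v) <= nrm u + nrm v.
Proof.
move=> Xu Xv; rewrite -(@ler_pXn2r _ 2)// ?nnegrE// ?addr_ge0//.
rewrite sqr_nrm//.
rewrite !(dotDl, dotDr)// sqrrD !sqr_nrm// (dotsC XP v u)//.
have := le_trans (ler_norm _) (cauchy_schwarz Xu Xv); lra.
Qed.

Lemma nrmB u v : X u -> X v -> nrm (u - v) <= nrm u + nrm v.
Proof. by move=> Xu Xv; rewrite -(nrmN Xv) nrmD. Qed.

Lemma nrm_dist u v w : X u -> X v -> X w -> nrm (u - w) <= nrm (u - v) + nrm (v - w).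
Proof. by move=> Xu Xv Xw; rewrite -[u - w](subrKA v) nrmD. Qed.

Lemma null_add u v : X u -> X v -> nrm u = 0 -> nrm v = 0 -> nrm (u + v) = 0.
Proof.
move=> Xu Xv u0 v0; apply/eqP; rewrite eq_le nrm_ge0 andbT.
by rewrite (le_trans (nrmD Xu Xv))// u0 v0 addr0.
Qed.

Lemma null_scale a u : X u -> nrm u = 0 -> nrm (a *: u) = 0.
Proof. by move=> Xu u0; rewrite nrmZ// u0 mulr0. Qed.

Lemma eqv_nrm u v : X u -> X v -> eqv dot u v -> nrm u = nrm v.
Proof.
move=> Xu Xv uv; apply/eqP; rewrite eq_le; apply/andP; split.
  by rewrite -[u](subrK v) (le_trans (nrmD _ _))// uv add0r.
rewrite -[v](subrK u) (le_trans (nrmD _ _))// nrmBC//.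
by move: uv; rewrite /eqv => ->; rewrite add0r.
Qed.

Lemma eqv_sym u v : X u -> X v -> eqv dot u v -> eqv dot v u.
Proof. by move=> Xu Xv; rewrite /eqv nrmBC. Qed.

Lemma eqv_trans v u w : X u -> X v -> X w ->
  eqv dot u v -> eqv dot v w -> eqv dot u w.
Proof.
by move=> Xu Xv Xw uv vw; rewrite /eqv -[u - w](subrKA v); exact: null_add.
Qed.

Lemma eqvxx u : eqv dot u u.
Proof. by rewrite /eqv subrr nrm0. Qed.

Lemma eqv_add u u' v v' : X u -> X u' -> X v -> X v' ->
  eqv dot u u' -> eqv dot v v' -> eqv dot (u + v) (u' + v').
Proof.
by move=> *; rewrite /eqv opprD addrACA; exact: null_add.
Qed.

Lemma eqv_scale a u v : X u -> X v -> eqv dot u v -> eqv dot (a *: u) (a *: v).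
Proof. by move=> *; rewrite /eqv -scalerBr; exact: null_scale. Qed.

Lemma eqv_sub u u' v v' : X u -> X u' -> X v -> X v' ->
  eqv dot u u' -> eqv dot v v' -> eqv dot (u - v) (u' - v').
Proof.
move=> *; apply: eqv_add => //.
by rewrite -[- v]scaleN1r -[- v']scaleN1r; exact: eqv_scale.
Qed.

Lemma eqv_sum (I : Type) (s : seq I) (b b' : I -> W) :
  (forall i, X (b i)) -> (forall i, X (b' i)) ->
  (forall i, eqv dot (b i) (b' i)) ->
  eqv dot (\sum_(i <- s) b i) (\sum_(i <- s) b' i).
Proof.
move=> Xb Xb' bb; elim: s => [|i s IH]; first by rewrite !big_nil; exact: eqvxx.
by rewrite !big_cons; apply: eqv_add.
Qed.

Lemma dot_null u v : X u -> X v -> nrm u = 0 -> dot u v = 0.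
Proof.
move=> Xu Xv u0; have := cauchy_schwarz Xu Xv.
by rewrite u0 mul0r normr_le0 => /eqP.
Qed.

Definition bounded_functional (f : W -> R) :=
  (forall a u v, X u -> X v -> f (a *: u + v) = a * f u + f v) /\
  exists C, forall u, X u -> `|f u| <= C * nrm u.

Section functional.
Context (f : W -> R).
Hypothesis fP : bounded_functional f.

Lemma functionalD u v : X u -> X v -> f (u + v) = f u + f v.
Proof. by move=> Xu Xv; rewrite -[u]scale1r fP.1// mul1r scale1r. Qed.

Lemma functional0 : f 0 = 0.
Proof. by apply: (addrI (f 0)); rewrite -functionalD// !addr0. Qed.

Lemma functionalZ a u : X u -> f (a *: u) = a * f u.
Proof. by move=> Xu; rewrite -[a *: u]addr0 fP.1// functional0 addr0. Qed.

Lemma functionalB u v : X u -> X v -> f (u - v) = f u - f v.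
Proof.
by move=> Xu Xv; rewrite functionalD// -scaleN1r functionalZ// mulN1r.
Qed.

Lemma functional_sum (I : Type) (s : seq I) (F : I -> W) :
  (forall i, X (F i)) -> f (\sum_(i <- s) F i) = \sum_(i <- s) f (F i).
Proof.
move=> XF; elim: s => [|i s IH]; first by rewrite !big_nil functional0.
by rewrite !big_cons functionalD ?IH//; apply: mem_sum.
Qed.

Lemma functional_null u : X u -> nrm u = 0 -> f u = 0.
Proof.
move=> Xu u0; have [C fC] := fP.2.
by have := fC _ Xu; rewrite u0 mulr0 normr_le0 => /eqP.
Qed.

Lemma functional_eqv u v : X u -> X v -> eqv dot u v -> f u = f v.
Proof.
move=> Xu Xv uv; apply/eqP; rewrite -subr_eq0 -functionalB//.
by rewrite functional_null.
Qed.

End functional.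

Section operator.
Context (T : W -> W).
Hypothesis TP : bounded_operator X dot T.

Lemma op_mem u : X u -> X (T u). Proof. by have [+ _ _] := TP; exact. Qed.
Ltac mem ::= repeat first [assumption | exact: mem0 | apply: memB | apply: memD
  | apply: memN | apply: memZ | apply: op_mem | apply: mem_sum => ?
  | match goal with H : forall _, X _ |- _ => exact: H end].

Lemma op_bound : exists2 C, 0 <= C & forall u, X u -> nrm (T u) <= C * nrm u.
Proof.
have [_ _ [C CT]] := TP; exists `|C| => // u Xu.
by rewrite (le_trans (CT _ Xu))// ler_wpM2r// ler_norm.
Qed.

Lemma opL a u v : X u -> X v -> eqv dot (T (a *: u + v)) (a *: T u + T v).
Proof. by have [_ + _] := TP; exact. Qed.

Lemma opB u v : X u -> X v -> eqv dot (T (u - v)) (T u - T v).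
Proof.
move=> Xu Xv; rewrite [u - v]addrC -scaleN1r [T u - _]addrC -[- T v]scaleN1r.
exact: opL.
Qed.

Lemma op_dist_le C u v : (forall w, X w -> nrm (T w) <= C * nrm w) ->
  X u -> X v -> nrm (T u - T v) <= C * nrm (u - v).
Proof.
by move=> TC Xu Xv; rewrite -(eqv_nrm _ _ (opB Xu Xv))// ?TC//.
Qed.

Lemma op_null u : X u -> nrm u = 0 -> nrm (T u) = 0.
Proof.
move=> Xu u0; have [C C0 TC] := op_bound.
by apply/eqP; rewrite eq_le nrm_ge0 andbT (le_trans (TC _ Xu))// u0 mulr0.
Qed.

Lemma opZ a u : X u -> eqv dot (T (a *: u)) (a *: T u).
Proof.
move=> Xu; rewrite /eqv -{1}[a *: u]addr0.
have -> : T (a *: u + 0) - a *: T u = (T (a *: u + 0) - (a *: T u + T 0)) + T 0.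
  by rewrite opprD addrA subrK.
by rewrite null_add ?op_null ?nrm0// (opL _ Xu mem0).
Qed.

Lemma op_sum (I : Type) (s : seq I) (c : I -> R) (b : I -> W) :
  (forall i, X (b i)) ->
  eqv dot (T (\sum_(i <- s) c i *: b i)) (\sum_(i <- s) c i *: T (b i)).
Proof.
move=> Xb; elim: s => [|i s IH].
  by rewrite !big_nil /eqv subr0 op_null ?nrm0.
rewrite !big_cons; apply: eqv_trans (opL _ _ _) _; try by mem.
by apply: eqv_add => //; try (by mem); exact: eqvxx.
Qed.

Lemma op_id_sub : bounded_operator X dot (fun u => u - T u).
Proof.
split; first by move=> u Xu; mem.
  move=> a u v Xu Xv; rewrite /eqv.
  have -> : a *: u + v - T (a *: u + v) - (a *: (u - T u) + (v - T v)) =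
    - (T (a *: u + v) - (a *: T u + T v)).
    rewrite scalerBr [a *: u - _ + _]addrACA -opprD !opprB.
    by rewrite [LHS]addrC subrKA.
  by rewrite nrmN// opL.
have [C C0 CT] := op_bound; exists (1 + C) => u Xu.
by rewrite (le_trans (nrmB _ _))// mulrDl mul1r lerD2l CT.
Qed.

Lemma functional_op f : bounded_functional f ->
  bounded_functional (f \o T).
Proof.
move=> fP; split=> [a u v Xu Xv|].
  rewrite /= (functional_eqv fP _ _ (opL a Xu Xv))//.
  by rewrite fP.1//; mem.
have [D fD] := fP.2; have [C C0 CT] := op_bound.
exists (`|D| * C) => u Xu /=.
rewrite (le_trans (fD _ _))//.
rewrite -mulrA (@le_trans _ _ (`|D| * nrm (T u)))//.
  by rewrite ler_wpM2r// ler_norm.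
by rewrite ler_wpM2l// CT.
Qed.

End operator.

Ltac mem ::= repeat first [assumption | exact: mem0 | apply: memB | apply: memD
  | apply: memN | apply: memZ | apply: mem_sum => ?
  | match goal with H : forall _, X _ |- _ => exact: H end].

(** * Riesz theory of compact operators *)

Definition unit_vectors (s : seq W) := {in s, forall e, X e /\ nrm e = 1}.

(** Projects out the vectors of [s] one after the other, starting from the last.
    For unit vectors each step is an orthogonal projection, so the norm does not
    increase. *)
Fixpoint residual (s : seq W) (u : W) : W :=
  if s is e :: s' then residual s' u - dot (residual s' u) e *: e else u.

Lemma unit_vectors_cons e s :
  unit_vectors (e :: s) <-> [/\ X e, nrm e = 1 & unit_vectors s].
Proof.
split=> [H|[Xe e1 H] x].
  have [Xe e1] := H e (mem_head _ _); split=> // x xs.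
  by apply: H; rewrite in_cons xs orbT.
by rewrite in_cons => /predU1P[->//|/H].
Qed.

Lemma residual_mem s u : unit_vectors s -> X u -> X (residual s u).
Proof.
by elim: s u => //= e s IH u /unit_vectors_cons[Xe _ /IH{}IH] /IH Xr.
Qed.

Lemma residualL s a u v : unit_vectors s -> X u -> X v ->
  residual s (a *: u + v) = a *: residual s u + residual s v.
Proof.
elim: s => //= e s IH /unit_vectors_cons[Xe _ us] Xu Xv.
have Xr := residual_mem us Xu; have Xr' := residual_mem us Xv.
by rewrite IH// (dotsL XP)// scalerBr scalerDl opprD scalerA addrACA.
Qed.

Lemma residualB s u v : unit_vectors s -> X u -> X v ->
  residual s (u - v) = residual s u - residual s v.
Proof.
move=> us Xu Xv; rewrite [u - v]addrC -scaleN1r residualL// scaleN1r.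
by rewrite addrC.
Qed.

Lemma nrm_reject_le u e : X u -> X e -> nrm e = 1 ->
  nrm (u - dot u e *: e) <= nrm u.
Proof.
move=> Xu Xe e1; rewrite -(@ler_pXn2r _ 2)// ?nnegrE// !sqr_nrm//.
rewrite !(dotDl, dotDr, dotNl, dotNr, dotZl, dotZr)// (dotsC XP e u)//.
by rewrite -[dot e e]sqr_nrm// e1; nra.
Qed.

Lemma residual_le s u : unit_vectors s -> X u -> nrm (residual s u) <= nrm u.
Proof.
move=> + Xu; elim: s => //= e s IH /unit_vectors_cons[Xe e1 us].
apply: le_trans (IH us); apply: nrm_reject_le => //; exact: residual_mem.
Qed.

Definition finite_rank (F : W -> W) :=
  exists r (psi : 'I_r -> W -> R) (e : 'I_r -> W),
    [/\ forall l, bounded_functional (psi l), forall l, X (e l)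
      & forall u, X u -> F u = \sum_(l < r) psi l u *: e l].

(** Each projection subtracts a multiple of a unit vector, with a coefficient
    that is a bounded functional of [u]. *)
Lemma residual_rank s : unit_vectors s ->
  finite_rank (fun u => u - residual s u).
Proof.
elim: s => [_|e s IH /unit_vectors_cons[Xe e1 us]].
  exists 0%N, (fun _ => fun=> 0), (fun=> 0); split=> [[]|[]|u Xu]//.
  by rewrite big_ord0/= subrr.
have [r [psi [b [psiP Xb E]]]] := IH us.
exists r.+1, (fun l => if unlift ord0 l is Some l' then psi l'
                    else fun u => dot (residual s u) e),
  (fun l => if unlift ord0 l is Some l' then b l' else e); split.
- move=> l; case: unliftP => [//|_]; split=> [a u v Xu Xv|].
    by rewrite residualL// (dotsL XP)//; exact: residual_mem.
  exists 1 => u Xu; have Xr := residual_mem us Xu.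
  rewrite (le_trans (cauchy_schwarz _ _))// e1 mulr1 mul1r.
  exact: residual_le.
- by move=> l; case: unliftP.
- move=> u Xu /=; rewrite big_ord_recl unlift_none opprB addrCA E//.
  by congr +%R; apply: eq_bigr => l _; rewrite liftK.
Qed.

Lemma cvg0_lt (a : nat -> R) : a n @[n --> \oo] --> (0 : R) ->
  forall e, 0 < e -> exists N, forall n, (N <= n)%N -> `|a n| < e.
Proof.
move=> /cvgrPdist_lt a0 e e0; have [N _ aN] := a0 e e0.
by exists N => n /aN; rewrite sub0r normrN.
Qed.

Section compact.
Context (K : W -> W).
Hypothesis Kcompact : compact_operator X dot K.
Let KP : bounded_operator X dot K. Proof. by case: Kcompact. Qed.

Ltac mem ::= repeat first [assumption | exact: mem0 | apply: memB | apply: memD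
  | apply: memN | apply: memZ | apply: (op_mem KP) | apply: mem_sum => ?
  | apply: residual_mem
  | match goal with H : forall _, X _ |- _ => exact: H end].

(** Otherwise one could choose vectors [u n] of norm at most 1 one after the
    other, each time adding to the list the normalized residual of [K (u n)].
    The residual of [K (u m)] vanishes at all later stages, so the images
    [K (u n)] would be at mutual distance more than [eps], and no subsequence of
    them could converge. *)
Lemma compact_residual (eps : R) : 0 < eps -> exists s, unit_vectors s /\
  forall u, X u -> nrm (residual s (K u)) <= eps * nrm u.
Proof.
move=> eps0; apply: contrapT => /forallNP noS.
have /choice[pick pickP] (s : seq W) : exists u, unit_vectors s ->
    [/\ X u, nrm u <= 1 & eps < nrm (residual s (K u))].
  have [us|] := pselect (unit_vectors s); last by exists 0.
  have := noS s; rewrite not_andE => -[//|/existsNP[u /not_implyP[Xu]]].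
  move/negP; rewrite -ltNge => ltu.
  have u0 : 0 < nrm u.
    rewrite lt_neqAle nrm_ge0 andbT eq_sym; apply/eqP => u0.
    move: ltu; rewrite u0 mulr0 ltNge => /negP; apply.
    by rewrite -(op_null KP Xu u0); exact: residual_le.
  exists ((nrm u)^-1 *: u) => _; split=> //.
    by rewrite nrmZ// ger0_norm ?invr_ge0// mulVf// gt_eqF.
  have -> : nrm (residual s (K ((nrm u)^-1 *: u))) =
      nrm (residual s ((nrm u)^-1 *: K u)).
    apply: eqv_nrm => //; rewrite /eqv -residualB//.
    apply/eqP; rewrite eq_le nrm_ge0 andbT (le_trans (residual_le _ _))//.
    by rewrite (opZ KP).
  rewrite -[_ *: K u]addr0 residualL//.
  have -> : residual s 0 = 0.
    by have := @residualB s 0 0 us mem0 mem0; rewrite !subrr.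
  rewrite addr0 nrmZ//.
    by rewrite ger0_norm ?invr_ge0// mulrC ltr_pdivlMr.
pose next s := (nrm (residual s (K (pick s))))^-1 *: residual s (K (pick s)).
pose ss n := iter n (fun s => next s :: s) [::].
have uss n : unit_vectors (ss n).
  elim: n => [|n IH]/=; first by [].
  have [Xu _ ltu] := pickP _ IH; apply/unit_vectors_cons; split=> //.
  have ge0 : 0 < nrm (residual (ss n) (K (pick (ss n)))).
    exact: lt_trans ltu.
  by rewrite /next nrmZ// ger0_norm ?invr_ge0// mulVf// gt_eqF.
pose u n := pick (ss n).
have Xu n : X (u n) by have [] := pickP _ (uss n).
have u1 n : nrm (u n) <= 1 by have [] := pickP _ (uss n).
have resu n : eps < nrm (residual (ss n) (K (u n))).
  by have [] := pickP _ (uss n).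
have null m n : (m < n)%N -> nrm (residual (ss n) (K (u m))) = 0.
  elim: n => // n IH; rewrite ltnS leq_eqVlt => /predU1P[->|/IH {}IH].
    rewrite /= -/(u n) /next -/(u n).
    set v := residual _ _; have Xv : X v by rewrite /v; have := uss n.
    have v0 : nrm v != 0 by rewrite gt_eqF// (lt_trans eps0)// /v.
    rewrite dotZr// -sqr_nrm// scalerA.
    rewrite (_ : _ * _ = 1); last by field.
    by rewrite scale1r subrr nrm0.
  have [Xe e1 us] := (unit_vectors_cons _ _).1 (uss n.+1).
  apply/eqP; rewrite eq_le nrm_ge0 andbT /= -IH.
  by apply: nrm_reject_le => //; exact: residual_mem.
have sep m n : (m < n)%N -> eps < nrm (K (u n) - K (u m)).
  move=> mn; apply: lt_le_trans (resu n) _.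
  apply: le_trans (residual_le (uss n) _) => //.
  rewrite residualB//.
  have Xa : X (residual (ss n) (K (u n))) by apply: residual_mem.
  have Xb : X (residual (ss n) (K (u m))) by apply: residual_mem.
  rewrite -{1}[residual (ss n) (K (u n))](subrK (residual (ss n) (K (u m)))).
  by rewrite (le_trans (nrmD _ _))// null// addr0.
have [_ /(_ u Xu)[]] := Kcompact; first by exists 1.
move=> s [w [smono Xw /cvg0_lt/(_ (eps / 2))[]]]; first by rewrite divr_gt0.
move=> N HN; have := sep (s N) (s N.+1) (smono _ _ (ltnSn N)).
apply/negP; rewrite -leNgt.
rewrite (le_trans (nrm_dist _ Xw _))// nrmBC// addrC nrmBC//.
have /HN := leqnn N; have /HN := leqnSn N; rewrite !ger0_norm// => H1 H2.
by rewrite [leRHS]splitr lerD// ltW// nrmBC.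
Qed.

Lemma residual_op s : unit_vectors s ->
  bounded_operator X dot (fun u => residual s (K u)).
Proof.
move=> us; have [C C0 CK] := op_bound KP.
split; [by move=> u Xu; mem|move=> a u v Xu Xv|exists C => u Xu].
  rewrite /eqv -residualL//; [|by mem..].
  rewrite -residualB//; [|by mem..].
  apply/eqP; rewrite eq_le nrm_ge0 andbT (le_trans (residual_le _ _))//.
  by rewrite (opL KP).
by rewrite (le_trans (residual_le _ _))// ?CK//; mem.
Qed.

Section contraction.
Context (s : seq W).
Hypothesis us : unit_vectors s.
Hypothesis sK : forall u, X u -> nrm (residual s (K u)) <= 2^-1 * nrm u.
Let B u := residual s (K u).

Let BP : bounded_operator X dot B := residual_op us.

Let XB u : X u -> X (B u). Proof. exact: (op_mem BP). Qed.

Ltac mem ::= repeat first [assumption | exact: mem0 | apply: memB | apply: memD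
  | apply: memN | apply: memZ | apply: (op_mem KP) | apply: mem_sum => ?
  | apply: XB | apply: residual_mem
  | match goal with H : forall _, X _ |- _ => exact: H end].

(** The iterates v_(n+1) = w + B v_n are Cauchy because B halves distances. The
    limit exists in [X] because a subsequence of K v_n converges. *)
Lemma neumann w : X w -> exists2 v, X v & eqv dot (v - B v) w.
Proof.
move=> Xw; pose v n := iter n (fun x => w + B x) 0.
have Xv n : X (v n) by elim: n => [|n IH]/=; mem.
have vS n : v n.+1 = w + B (v n) by [].
have vle n : nrm (v n) <= 2 * nrm w.
  elim: n => [|n IH]; first by rewrite /= nrm0 mulr_ge0.
  rewrite vS (le_trans (nrmD _ _))//.
  have := sK (Xv n); rewrite -/(B (v n)); have := nrm_ge0 w; lra.
pose d := nrm (v 1 - v 0).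
have dist n : nrm (v n.+1 - v n) <= geometric d 2^-1 n.
  elim: n => [|n IH]; first by rewrite /geometric/= expr0 mulr1.
  have -> : v n.+2 - v n.+1 = B (v n.+1) - B (v n).
    rewrite -[LHS]/(w + B (v n.+1) - (w + B (v n))).
    by rewrite opprD addrACA subrr add0r.
  have -> : geometric d 2^-1 n.+1 = 2^-1 * geometric d 2^-1 n.
    by rewrite /geometric/= exprS mulrCA.
  apply: le_trans (op_dist_le BP sK (Xv _) (Xv _)) _.
  by rewrite ler_pM2l ?invr_gt0.
have dist0 : geometric d 2^-1 n @[n --> \oo] --> (0 : R).
  by apply: cvg_geometric; rewrite ger0_norm ?invr_ge0// invf_lt1 ?ltr1n.
have [_ /(_ v Xv)[]] := Kcompact; first by exists (2 * nrm w).
move=> k [x [kmono Xx xlim]].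
have kge n : (n <= k n)%N.
  by elim: n => // n IH; rewrite (leq_ltn_trans IH)// kmono.
pose z := w + residual s x; have Xz : X z by mem.
exists z => //; apply/eqP; rewrite eq_le nrm_ge0 andbT.
apply/ler_addgt0Pr => e e0; rewrite add0r.
have e4 : 0 < e / 4 by rewrite divr_gt0.
have [N1 HN1] := cvg0_lt dist0 e4.
have [N2 HN2] := cvg0_lt xlim e4.
pose n := maxn N1 N2.
have h1 : nrm (v (k n).+1 - v (k n)) <= e / 4.
  apply: le_trans (dist _) _; apply: le_trans (ler_norm _) (ltW (HN1 _ _)).
  exact: leq_trans (leq_maxl _ _) (kge n).
have h2 : nrm (v (k n).+1 - z) <= e / 4.
  rewrite vS /z opprD addrACA subrr add0r /B -residualB//.
  apply: le_trans (residual_le _ _) _ => //.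
  apply: le_trans (ler_norm _) (ltW (HN2 _ _)); exact: leq_maxr.
have h3 : nrm (v (k n) - z) <= e / 2.
  apply: le_trans (nrm_dist (Xv _) (Xv (k n).+1) Xz) _.
  by rewrite nrmBC//; lra.
have h4 : nrm (B (v (k n)) - B z) <= e / 4.
  apply: le_trans (op_dist_le BP sK (Xv _) Xz) _; lra.
have -> : z - B z - w = (z - v (k n).+1) + (B (v (k n)) - B z).
  by rewrite vS opprD [z + (- w - _)]addrA subrKA addrAC.
by rewrite (le_trans (nrmD _ _))// nrmBC//; lra.
Qed.

Lemma contraction_inj v : X v -> nrm (v - B v) = 0 -> nrm v = 0.
Proof.
move=> Xv v0; apply/eqP; rewrite eq_le nrm_ge0 andbT.
have := sK Xv; rewrite -/(B v) -(eqv_nrm Xv (XB Xv) v0).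
have := nrm_ge0 v; lra.
Qed.

End contraction.

(** Write K = B + F, where B halves norms and F u = sum_l psi_l(u) e_l has finite
    rank, and let a_l solve (I - B) a_l = e_l. With M the matrix of the psi_l on
    the a_l and row vectors c:
    - u is in the kernel iff u = sum_l c_l a_l with c = c M, and c is determined
      by u as the vector of the psi_l(u);
    - every w is, modulo the range, a combination of the e_l, and
      sum_l c_l e_l is in the range iff c is in the row space of 1 - M.
    Both the kernel and the cokernel thus have dimension r - rank (1 - M). *)
Theorem fredholm_compact : fredholm_index X dot (fun u => u - K u) 0.
Proof.
split; first exact: op_id_sub.
have half : 0 < 2^-1 :> R by rewrite invr_gt0.
have [s [us sK]] := compact_residual half.
have [r [psi0 [e [psi0P Xe FE]]]] := residual_rank us.
pose psi l := psi0 l \o K.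
have psiP l : bounded_functional (psi l) by apply: (functional_op KP).
pose B u := residual s (K u).
have XB u : X u -> X (B u) by move=> Xu; rewrite /B; mem.
have KE u : X u -> K u = B u + \sum_(l < r) psi l u *: e l.
  by move=> Xu; rewrite -FE; [rewrite addrC subrK|mem].
have /choice[a aP] l : exists v, X v /\ eqv dot (v - B v) (e l).
  by have [v Xv ev] := neumann us sK (Xe l); exists v.
have Xa l : X (a l) by case: (aP l).
have ae l : eqv dot (a l - B (a l)) (e l) by case: (aP l).
pose comb (b : 'I_r -> W) (c : 'rV[R]_r) := \sum_(l < r) c 0 l *: b l.
have Xcomb b c : (forall l, X (b l)) -> X (comb b c).
  by move=> Xb; rewrite /comb; mem.
have Xae c : X (comb a c) /\ X (comb e c) by split; apply: Xcomb.
have combB b c c' : comb b c - comb b c' = comb b (c - c').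
  by rewrite -sumrB; apply: eq_bigr => l _; rewrite !mxE scalerBl.
(* the coordinates of F u on the e_l *)
pose Psi u : 'rV[R]_r := \row_l psi l u.
pose M : 'M[R]_r := \matrix_(i, l) psi l (a i).
pose D := 1%:M - M.
have PsiB u v : X u -> X v -> Psi (u - v) = Psi u - Psi v.
  by move=> Xu Xv; apply/rowP => l; rewrite !mxE (functionalB (psiP l)).
have Psi_eqv u v : X u -> X v -> eqv dot u v -> Psi u = Psi v.
  move=> Xu Xv uv; apply/rowP => l; rewrite !mxE.
  exact: (functional_eqv (psiP l)).
have Psi_comb c : Psi (comb a c) = c *m M.
  apply/rowP => l; rewrite !mxE (functional_sum (psiP l)); last by move=> i; mem.
  by apply: eq_bigr => i _; rewrite mxE (functionalZ (psiP l)).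
have DE c : c *m D = c - c *m M by rewrite mulmxBr mulmx1.
pose L u := u - B u.
have BP : bounded_operator X dot B := residual_op us.
have LP : bounded_operator X dot L := op_id_sub BP.
have XL u : X u -> X (L u) by move=> Xu; apply: (op_mem LP).
have SE u : X u -> u - K u = L u - comb e (Psi u).
  move=> Xu; rewrite KE// opprD addrA; congr (_ - _).
  by apply: eq_bigr => l _; rewrite mxE.
have Lcomb c : eqv dot (L (comb a c)) (comb e c).
  apply: eqv_trans (op_sum LP _ _ Xa) _; try by mem.
  by apply: eqv_sum => i; [mem|mem|apply: eqv_scale => //; exact: ae].
have Linj u c : X u -> eqv dot (L u) (comb e c) -> eqv dot u (comb a c).
  move=> Xu Luc; have [Xac Xec] := Xae c.
  apply: (contraction_inj us sK); first by mem.
  rewrite -[nrm _]/(nrm (L (u - comb a c))) -nrm0.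
  apply: eqv_nrm; [by mem..|].
  apply: (eqv_trans (v := L u - L (comb a c))); [by mem..|exact: (opB LP)|].
  rewrite -(subrr (comb e c)); apply: eqv_sub => //; by mem.
have combM b n (N : 'M[R]_(n, r)) (c : 'rV[R]_n) :
    \sum_(i < n) c 0 i *: comb b (row i N) = comb b (c *m N).
  rewrite /comb; under eq_bigr do rewrite scaler_sumr.
  rewrite exchange_big; apply: eq_bigr => l _ /=.
  by rewrite mxE scaler_suml; apply: eq_bigr => i _; rewrite mxE scalerA.
exists (\rank (kermx D)), (\rank D^C%MS); split.
- pose N := row_base (kermx D).
  have NM : N *m M = N.
    apply/eqP; rewrite eq_sym -subr_eq0 -DE; apply/eqP/sub_kermxP.
    by rewrite /N eq_row_base.
  exists (fun i => comb a (row i N)); split=> [i|u [Xu uS]].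
    have [Xai Xei] := Xae (row i N).
    by split=> //; rewrite SE// Psi_comb -row_mul NM /eqv subr0; exact: Lcomb.
  have uc : eqv dot u (comb a (Psi u)).
    by apply: Linj => //; move: uS; rewrite SE// /eqv subr0.
  have cM : Psi u = Psi u *m M.
    rewrite -Psi_comb; apply: Psi_eqv => //.
  have : (Psi u <= N)%MS.
    rewrite /N eq_row_base; apply/sub_kermxP; rewrite DE.
    by apply/eqP; rewrite subr_eq0; apply/eqP.
  case/submxP => c cE; exists c; split.
    have [Xau _] := Xae (Psi u).
    by rewrite combM -cE; split; [mem|rewrite /eqv subr0].
  move=> y; rewrite combM => -[_]; rewrite /eqv subr0 => uy.
  apply: (row_free_inj (row_base_free (kermx D))); rewrite -/N -cE.
  rewrite -NM mulmxA -Psi_comb; exact: Psi_eqv.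
- pose N := row_base (D^C)%MS.
  have Sran b : X (comb a b) /\
      eqv dot (comb e (b *m D)) (comb a b - K (comb a b)).
    have [Xab Xeb] := Xae b; have [_ Xebm] := Xae (b *m M).
    split=> //; rewrite SE// DE -combB Psi_comb; apply: eqv_sub => //.
    - by apply: eqv_sym => //; by mem.
    - exact: eqvxx.
  exists (fun i => comb e (row i N)); split=> [i|w Xw].
    by have [] := Xae (row i N).
  have [v Xv vw] := neumann us sK Xw.
  have : (Psi v <= D + D^C)%MS.
    by apply: submx_full; exact: addsmx_compl_full.
  case/sub_addsmxP => -[x y'] /= cE.
  have : (y' *m D^C%MS <= N)%MS by rewrite /N eq_row_base submxMl.
  case/submxP => y yE; rewrite {}yE {y'} in cE.
  have [Xax Sx] := Sran x.
  have [_ Xey] := Xae (y *m N); have [_ Xev] := Xae (Psi v).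
  have [_ Xex] := Xae (x *m D).
  exists y; split.
    rewrite combM; exists (v + comb a x); first by mem.
    apply: (eqv_trans (v := (v - K v) + (comb a x - K (comb a x)))); try by mem.
      apply: (eqv_trans (v := (v - K v) + comb e (x *m D))); try by mem.
        rewrite SE// -addrA; apply: eqv_add; try by mem.
          by apply: eqv_sym => //; by mem.
        have -> : - comb e (Psi v) + comb e (x *m D) = - comb e (y *m N).
          rewrite addrC -opprB combB cE; congr (- comb e _).
          by rewrite addrAC subrr add0r.
        exact: eqvxx.
      by apply: eqv_add => //; [by mem..|exact: eqvxx].
    have KD : eqv dot (v + comb a x - K (v + comb a x))
        (v - K v + (comb a x - K (comb a x))).
      have := opL (op_id_sub KP) 1 Xv Xax.
      by rewrite !scale1r.
    by apply: eqv_sym => //; by mem.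
  move=> z; rewrite !combM => -[u Xu uz].
  have [_ Xez] := Xae (z *m N); have [_ Xeu] := Xae (Psi u).
  have [_ Xed] := Xae (z *m N - Psi u).
  have vuE : eqv dot (v - u) (comb a (z *m N - Psi u)).
    apply: Linj; first by mem.
    apply: (eqv_trans (v := L v - L u)); [by mem..|exact: (opB LP)|].
    rewrite -combB /eqv.
    have -> : L v - L u - (comb e (z *m N) - comb e (Psi u)) =
        (L v - w) + (w - comb e (z *m N) - (u - K u)).
      rewrite SE// addrA subrKA !opprB [LHS]addrACA [RHS]addrACA.
      by congr (_ + _); exact: addrC.
    by apply: null_add => //; by mem.
  have : Psi v - Psi u = (z *m N - Psi u) *m M.
    by rewrite -PsiB// -Psi_comb; apply: Psi_eqv => //; mem.
  rewrite cE => PE.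
  have zy : (z - y) *m N = (x + (z *m N - Psi u)) *m D.
    rewrite mulmxBl mulmxDl [in RHS](DE _ (_ - _)) -PE !opprB subrKA.
    by rewrite [RHS]addrCA opprD (addrA (x *m D)) subrr add0r.
  have : ((z - y) *m N <= D :&: D^C)%MS.
    rewrite sub_capmx {1}zy submxMl/=.
    by rewrite (submx_trans (submxMl _ _))// /N eq_row_base.
  rewrite capmx_compl submx0 mulmxBl subr_eq0 => /eqP /esym.
  exact: (row_free_inj (row_base_free _)).
- by rewrite mxrank_ker mxrank_compl subrr.
Qed.

Section injective.
Hypothesis Kinj : forall u, X u -> nrm (u - K u) = 0 -> nrm u = 0.
Let S u := u - K u.
Let SP : bounded_operator X dot S := op_id_sub KP.

Ltac mem ::= repeat first [assumption | exact: mem0 | apply: memB | apply: memD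
  | apply: memN | apply: memZ | apply: (op_mem KP) | apply: (op_mem SP)
  | apply: mem_sum => ?
  | match goal with H : forall _, X _ |- _ => exact: H end].

Let Sinj u v : X u -> X v -> eqv dot (S u) (S v) -> eqv dot u v.
Proof.
move=> Xu Xv uv; apply: Kinj; first by mem.
rewrite -nrm0.
apply: (eqv_nrm _ _ (eqv_trans (v := S u - S v) _ _ _ (opB SP Xu Xv) _));
  try by mem.
by rewrite -(subrr (S v)); apply: eqv_sub => //; [by mem..|exact: eqvxx].
Qed.

(** Unit vectors [u n] with [S (u n)] tending to 0 would have a subsequence
    converging to a limit of [K (u n)], a unit vector in the kernel. *)
Let Sbelow : exists C, forall u, X u -> nrm u <= C * nrm (S u).
Proof.
apply: contrapT => /forallNP noC.
have /choice[u uP] (n : nat) : exists u, [/\ X u, nrm u = 1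
    & nrm (S u) < n.+1%:R^-1].
  have /existsNP[u /not_implyP[Xu /negP]] := noC n.+1%:R.
  rewrite -ltNge => ltu; have u0 : 0 < nrm u.
    by apply: le_lt_trans ltu; rewrite mulr_ge0.
  exists ((nrm u)^-1 *: u); split; first by mem.
    by rewrite nrmZ// ger0_norm ?invr_ge0// mulVf// gt_eqF.
  rewrite (eqv_nrm _ _ (opZ SP _ Xu)); [|by mem..].
  rewrite nrmZ; last by mem.
  rewrite ger0_norm ?invr_ge0// mulrC ltr_pdivrMr//.
  by rewrite mulrC ltr_pdivlMr// mulrC.
have Xu n : X (u n) by case: (uP n).
have [_ /(_ u Xu)[]] := Kcompact; first by exists 1 => n; case: (uP n) => _ ->.
move=> k [w [kmono Xw wlim]].
have kge n : (n <= k n)%N.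
  by elim: n => // n IH; rewrite (leq_ltn_trans IH)// kmono.
have [C C0 SC] := op_bound SP.
have near e : 0 < e -> exists n, nrm (u n - w) <= e /\ nrm (S (u n)) <= e.
  move=> e0; have e2 : 0 < e / 2 by rewrite divr_gt0.
  have [N1 HN1] := cvg0_lt wlim e2.
  have [N2 HN2] := cvg0_lt (@cvg_harmonic R) e2.
  pose n := maxn N1 N2; exists (k n).
  have h1 : nrm (S (u (k n))) <= e / 2.
    have [_ _ /ltW/le_trans->//] := uP (k n).
    apply: le_trans (ler_norm _) (ltW (HN2 _ _)).
    exact: leq_trans (leq_maxr _ _) (kge n).
  have h2 : nrm (K (u (k n)) - w) <= e / 2.
    by apply: le_trans (ler_norm _) (ltW (HN1 _ _)); exact: leq_maxl.
  split; last by lra.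
  have -> : u (k n) - w = S (u (k n)) + (K (u (k n)) - w).
    by rewrite addrA subrK.
  by rewrite (le_trans (nrmD _ _))//; lra.
have w0 : nrm w = 0.
  apply: Kinj => //; apply/eqP; rewrite eq_le nrm_ge0 andbT.
  apply/ler_addgt0Pr => e e0; rewrite add0r.
  have C1 : 0 < C + 1 by rewrite ltr_wpDl.
  have [|n [h1 h2]] := near (e / (C + 1)); first by rewrite divr_gt0.
  have -> : w - K w = (S w - S (u n)) + S (u n) by rewrite subrK.
  rewrite (le_trans (nrmD _ _))//; [by mem..|].
  have h3 : nrm (S w - S (u n)) <= C * (e / (C + 1)).
    apply: le_trans (op_dist_le SP SC Xw (Xu n)) _.
    by rewrite ler_wpM2l// nrmBC.
  apply: le_trans (lerD h3 h2) _.
  by rewrite -[X in _ + X <= _]mul1r -mulrDl mulrC divfK// gt_eqF.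
have [|n [h1 _]] := near 2^-1; first by rewrite invr_gt0.
have [_ u1 _] := uP n.
have : nrm (u n) <= nrm (u n - w) + nrm w.
  by rewrite -{1}[u n](subrK w) nrmD//; mem.
by rewrite u1 w0 addr0 => /le_trans/(_ h1); rewrite leNgt invf_lt1 ?ltr1n.
Qed.

(** The index is zero and the kernel is trivial, so the range is everything; the
    inverse is bounded because [S] is bounded below. *)
Theorem compact_invertible : invertible_operator X dot S.
Proof.
split=> //; have [_ [n [m [[b [bK Hker]] [b' [_ Hran]] nm]]]] := fredholm_compact.
have {}nm : n = m by move/eqP: nm; rewrite eq_sym subr_eq0 eqz_nat => /eqP.
case: n b bK Hker nm => [|n] b bK Hker nm; last first.
  have K0 : Defs.kernel X dot S 0.
    split; first by mem.
    by rewrite /eqv subr0 (op_null SP) ?nrm0//; mem.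
  have [c [_ cuniq]] := Hker 0 K0.
  have bc (c' : 'rV[R]_n.+1) :
      X (0 - \sum_(i < n.+1) c' 0 i *: b i) /\
      eqv dot (0 - \sum_(i < n.+1) c' 0 i *: b i) 0.
    have Xb i : X (b i) by case: (bK i).
    split; first by mem.
    rewrite -[X in eqv _ _ X](subrr 0); apply: eqv_sub; [by mem..|exact: eqvxx|].
    have E0 : \sum_(i < n.+1) (0 : W) = 0 by rewrite big1.
    rewrite -[X in eqv _ _ X]E0.
    apply: eqv_sum => [i|i|i]; [by mem..|rewrite /eqv subr0].
    apply: null_scale => //; have [_] := bK i; rewrite /eqv subr0.
    exact: Kinj.
  have := cuniq _ (bc (const_mx 0)); rewrite (cuniq _ (bc (const_mx 1))).
  by move/matrixP => /(_ 0 0); rewrite !mxE => /eqP; rewrite oner_eq0.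
move: b' Hran; rewrite -nm => b' Hran.
have /choice[T' T'P] w : exists u, X w -> X u /\ eqv dot (S u) w.
  have [Xw|] := pselect (X w); last by exists 0.
  have [c [[u Xu uw] _]] := Hran w Xw; exists u => _; split=> //.
  rewrite big_ord0 subr0 in uw.
  by apply: eqv_sym => //; mem.
have XT' w : X w -> X (T' w) by move=> /T'P[].
have ST' w : X w -> eqv dot (S (T' w)) w by move=> /T'P[].
have [C SC] := Sbelow.
exists T'; last first.
  move=> u Xu; split; first exact: ST'.
  apply: Sinj; [by apply: XT'; mem|by []|].
  by apply: ST'; mem.
split=> // [a u v Xu Xv|].
  apply: Sinj; [by apply: XT'; mem|by apply: memD; [apply: memZ|]; apply: XT'|].
  have [Xu' Xv'] := (XT' u Xu, XT' v Xv).
  apply: (eqv_trans (v := a *: u + v)); [by apply/(op_mem SP)/XT'; mem|by mem|by mem| |].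
    by apply: ST'; mem.
  apply: (eqv_trans (v := a *: S (T' u) + S (T' v))); [by mem..| |].
    apply: eqv_add; [by mem..| |]; last by apply: eqv_sym; [mem|mem|exact: ST'].
    by apply: eqv_scale; [mem|mem|apply: eqv_sym; [mem|mem|exact: ST']].
  by apply: eqv_sym; [mem..|exact: (opL SP)].
exists C => u Xu; apply: le_trans (SC _ (XT' u Xu)) _.
rewrite (eqv_nrm _ _ (ST' u Xu))//.
by apply/(op_mem SP)/XT'.
Qed.

End injective.

End compact.

Section orthonormal.
Implicit Types E : set W.

Definition orthonormal E :=
  E `<=` X /\ forall e e', E e -> E e' -> dot e e' = (e == e')%:R.

(** Zorn's lemma: a vector orthogonal to a maximal orthonormal set has norm zero,
    since otherwise its normalization could be added to the set. *)
Lemma orthonormal_basis_exists : exists E, orthonormal_basis X dot E.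
Proof.
have [F FP totF|E [[EX Eo] Emax]] := @Zorn_bigcup W orthonormal.
  split=> [x [A /FP[AX _] /AX]//|e e' [A FA Ae] [B FB Be']].
  have [AB|BA] := totF A B FA FB.
    by have [_] := FP B FB; apply=> //; exact: AB.
  by have [_] := FP A FA; apply=> //; exact: BA.
exists E; split=> // u Xu uE; apply: contrapT => /eqP u0.
have u1 : nrm u ^+ 2 != 0 by rewrite expf_neq0.
pose e := (nrm u)^-1 *: u; have Xe : X e by exact: memZ.
have ee : dot e e = 1 by rewrite dotZl// dotZr// -sqr_nrm//; field.
have eE x : E x -> dot e x = 0 by move=> Ex; rewrite dotZl ?uE ?mulr0//; exact: EX.
have Ee : ~ E e by move=> /eE; rewrite ee => /eqP; rewrite oner_eq0.
apply: (Emax (E `|` [set e])).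
  by split; [move=> x; left|move=> /(_ e (or_intror erefl))].
split=> [x [/EX//|->//]|x y [Ex|->] [Ey|->]].
- exact: Eo.
- rewrite (dotsC XP) ?eE//; last exact: EX.
  by case: eqP => // xe; case: Ee; rewrite -xe.
- by rewrite eE//; case: eqP => // xe; case: Ee; rewrite xe.
- by rewrite ee eqxx.
Qed.

(** For orthonormal vectors, projecting out [e] lowers the squared norm by exactly
    [dot u e ^+ 2], because the projections already done do not change the inner
    product with [e]. *)
Lemma bessel E (s : seq W) u : orthonormal E -> X u ->
  uniq s -> {in s, forall e, E e} ->
  \sum_(e <- s) dot u e ^+ 2 <= dot u u.
Proof.
move=> [EX Eo] Xu us sE.
have unit (t : seq W) : {in t, forall e, E e} -> unit_vectors t.
  move=> tE e /tE Ee; split; first exact: EX.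
  by rewrite /Defs.nrm Eo// eqxx sqrtr1.
suff [-> _] : dot u u = dot (residual s u) (residual s u) + \sum_(e <- s) dot u e ^+ 2 /\
    forall e, E e -> e \notin s -> dot (residual s u) e = dot u e.
  rewrite lerDr (dots_ge0 XP)//; exact: residual_mem (unit _ sE) Xu.
elim: s us sE => [_ _|e s IH /= /andP[es us] sE].
  by rewrite big_nil addr0.
have sE' : {in s, forall e, E e} by move=> x xs; apply: sE; rewrite in_cons xs orbT.
have Ee : E e by apply: sE; exact: mem_head.
have Xe := EX _ Ee.
have [IH1 IH2] := IH us sE'; have Xr := residual_mem (unit _ sE') Xu.
split=> [|e' Ee']; last first.
  rewrite in_cons negb_or => /andP[e'e e's]; have Xe' := EX _ Ee'.
  by rewrite dotDl// dotNl// dotZl// (IH2 e')// (Eo e e')// eq_sym (negbTE e'e) mulr0 subr0.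
rewrite big_cons !(dotDl, dotDr, dotNl, dotNr, dotZl, dotZr)//.
rewrite (dotsC XP e (residual s u))// (IH2 e)// (Eo e e)// eqxx mulr1 {1}IH1 /=.
ring.
Qed.

End orthonormal.
End semi_inner_theory.

(** * The Hausdorff measure on closed sets and on hyperplanes *)

Section euclid.
Context (R : realType) (d : nat).
Local Notation V := 'rV[R]_d.
Implicit Types x y z : V.

Lemma dotv_semi_inner : semi_inner [set: V] (@dotv R d).
Proof.
split=> // [x y _ _|a x y z _ _ _|x _].
- by rewrite /dotv; apply: eq_bigr => i _; rewrite mulrC.
- rewrite /dotv mulr_sumr -big_split; apply: eq_bigr => i _ /=.
  by rewrite !mxE mulrDl mulrA.
- by apply: sumr_ge0 => i _; rewrite -expr2 sqr_ge0.
Qed.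

Lemma edist_ge0 x y : 0 <= edist x y. Proof. exact: sqrtr_ge0. Qed.

Lemma edistC x y : edist x y = edist y x.
Proof. exact: (nrmBC dotv_semi_inner). Qed.

Lemma edist_triangle y x z : edist x z <= edist x y + edist y z.
Proof. exact: (nrm_dist dotv_semi_inner). Qed.

Lemma coord_le_edist x y i : `|x 0 i - y 0 i| <= edist x y.
Proof.
rewrite -(@ler_pXn2r _ 2)// ?nnegrE ?edist_ge0// real_normK ?num_real//.
rewrite sqr_sqrtr; last exact: (dots_ge0 dotv_semi_inner).
rewrite /dotv (bigD1 i)//= !mxE -expr2 lerDl.
by apply: sumr_ge0 => j _; rewrite -expr2 sqr_ge0.
Qed.

Lemma norm_le_edist x y : `|x - y| <= edist x y.
Proof.
rewrite {1}/Num.norm/= mx_normrE; apply/bigmax_leP; split; first exact: edist_ge0.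
by move=> [i j] _ /=; rewrite !mxE ord1; exact: coord_le_edist.
Qed.

Lemma coord_le_norm x i : `|x 0 i| <= `|x|.
Proof.
rewrite [leRHS]/Num.norm/= mx_normrE.
exact: (@le_bigmax _ R _ _ (fun ij : 'I_1 * 'I_d => `|x ij.1 ij.2|) (0, i)).
Qed.

Lemma edist_le_norm x y : edist x y <= d%:R * `|x - y|.
Proof.
have h0 : 0 <= d%:R * `|x - y| by rewrite mulr_ge0.
rewrite -(@ler_pXn2r _ 2)// ?nnegrE ?edist_ge0//.
rewrite sqr_sqrtr; last exact: (dots_ge0 dotv_semi_inner).
apply: (@le_trans _ _ (\sum_(i < d) `|x - y| ^+ 2)).
  apply: ler_sum => i _; rewrite -expr2 -[_ ^+ 2]real_normK ?num_real//.
  by rewrite lerXn2r// ?nnegrE// coord_le_norm.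
rewrite sumr_const card_ord -[leLHS]mulr_natl exprMn ler_wpM2r// ?sqr_ge0//.
by rewrite -natrX ler_nat; case: (d) => // n; rewrite expnS expn1 leq_pmulr.
Qed.

Lemma closed_edist_gt0 (F : set V) x : closed F -> ~ F x ->
  exists2 r : R, 0 < r & forall y, F y -> r <= edist x y.
Proof.
move=> /closed_openC Fo Fx; have /nbhs_ballP[r /= r0 xr] := open_nbhs_nbhs (conj Fo Fx).
exists r => // y Fy; rewrite leNgt; apply/negP => xy; apply: (xr y) => //.
by rewrite -ball_normE/=; apply: le_lt_trans xy; exact: norm_le_edist.
Qed.

End euclid.

Section hausdorff_metric.
Context (R : realType) (d : nat).
Local Notation V := 'rV[R]_d.
Local Open Scope ereal_scope.
Local Notation H := (@hausdorff R d).
Local Notation pre := (@hausdorff_pre R d).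

Lemma le_hausdorff_pre s (r r' : R) (A : set V) : (r <= r')%R ->
  pre s r' A <= pre s r A.
Proof.
move=> rr'; apply: ereal_inf_le_tmp => _ [F [sF AF] <-]; exists F => //.
by split=> // k; rewrite (le_trans (sF k))// lee_fin.
Qed.

(** A set of diameter at most [r] cannot meet both [A] and [B], so a cover of the
    union splits into a cover of [A] and a cover of [B]. *)
Lemma hausdorff_pre_separated s (r : R) (A B : set V) :
  (forall x y, A x -> B y -> (r < edist x y)%R) ->
  pre s r A + pre s r B <= pre s r (A `|` B).
Proof.
move=> AB; apply: le_ereal_inf_tmp => _ [F [sF ABF] <-].
pose part (C : set V) k : set V := if `[< F k `&` C !=set0 >] then F k else set0.
have cov C : C `<=` A `|` B ->
    pre s r C <= \sum_(k <oo) hausdorff_gauge s (part C k).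
  move=> CAB; apply: ereal_inf_lbound; exists (part C) => //; split=> [k|x Cx].
    by rewrite /part; case: ifP => _ //; rewrite diam0 leNye.
  have [k _ Fx] := ABF _ (CAB _ Cx); exists k => //.
  by rewrite /part asboolT//; exists x.
apply: le_trans (leeD (cov A _) (cov B _)) _; [by left|by right|].
rewrite -nneseriesD; [|by move=> *; exact: hausdorff_gauge_ge0..].
apply: lee_nneseries => [k _ _|k _].
  by apply: adde_ge0; exact: hausdorff_gauge_ge0.
rewrite /part; case: asboolP => [[x [Fx Ax]]|_]; last first.
  rewrite hausdorff_gauge0 add0e; case: asboolP => // _.
  by rewrite hausdorff_gauge0 hausdorff_gauge_ge0.
case: asboolP => [[y [Fy By]]|_]; last by rewrite hausdorff_gauge0 adde0.
have := AB x y Ax By; rewrite ltNge => /negP; case.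
rewrite -lee_fin; apply: le_trans (sF k); apply: ereal_sup_ubound.
by exists (x, y).
Qed.

Lemma hausdorff_separated s (r : R) (A B : set V) : (0 < r)%R ->
  (forall x y, A x -> B y -> (r <= edist x y)%R) ->
  H s A + H s B <= H s (A `|` B).
Proof.
move=> r0 AB.
have [->|fin] := eqVneq (H s (A `|` B)) +oo; first by rewrite leey.
have fin_le C : C `<=` A `|` B -> H s C \is a fin_num.
  move=> CAB; rewrite ge0_fin_numE ?hausdorff_ge0//.
  by apply: le_lt_trans (le_hausdorff s CAB) _; rewrite ltey.
have finB : H s B \is a fin_num by apply: fin_le; right.
rewrite -leeBrDr//; apply: ge_ereal_sup => _ [r1 /= r10 <-].
have finpre : pre s r1 A \is a fin_num.
  rewrite ge0_fin_numE ?hausdorff_pre_ge0//.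
  apply: le_lt_trans (hausdorff_pre_le s A r10) _.
  by rewrite -ge0_fin_numE ?hausdorff_ge0//; apply: fin_le; left.
rewrite leeBrDr// addeC -leeBrDr//; apply: ge_ereal_sup => _ [r2 /= r20 <-].
rewrite leeBrDr// addeC.
pose t := Num.min (Num.min r1 r2) (r / 2)%R.
have t0 : (0 < t)%R by rewrite !lt_min r10 r20 divr_gt0.
apply: le_trans (leeD (@le_hausdorff_pre s t r1 A _) (@le_hausdorff_pre s t r2 B _)) _.
- by rewrite !ge_min lexx.
- by rewrite !ge_min lexx orbT.
apply: le_trans (hausdorff_pre_le _ _ t0).
apply: hausdorff_pre_separated => x y Ax By; apply: lt_le_trans (AB _ _ Ax By).
by rewrite /t gt_min; apply/orP; right; lra.
Qed.

(** Caratheodory's criterion. The part [far n] of [X] at distance at least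
    1/(n+1) from [F] is separated from [F], so it is enough that the measures of
    the [far n] exhaust that of [X] minus [F]. Since [far n] is separated from
    the shell between [far n.+1] and [far n.+2], the measure of that shell is at
    most the increase of the measure from [far n] to [far n.+2]; these bounds
    telescope, and the measure of what lies beyond [far m] tends to 0. *)
Lemma closed_caratheodory s (F : set V) : closed F ->
  (H s : set V -> \bar R).-caratheodory F.
Proof.
move=> Fc; apply: le_caratheodory_measurable => X.
change (H s (X `&` F) + H s (X `&` ~` F) <= H s X).
have [->|finX] := eqVneq (H s X) +oo; first by rewrite leey.
have fin C : C `<=` X -> H s C \is a fin_num.
  move=> CX; rewrite ge0_fin_numE ?hausdorff_ge0//.
  by apply: le_lt_trans (le_hausdorff s CX) _; rewrite ltey.
pose far n : set V := X `&` [set x | forall y, F y -> (n.+1%:R^-1 <= edist x y)%R].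
have far_fin n : H s (far n) \is a fin_num by apply: fin => x [].
pose shell n := far n.+1 `\` far n.
have shell_fin n : H s (shell n) \is a fin_num by apply: fin => x [[]].
pose a n := fine (H s (far n)); pose rho n := fine (H s (shell n)).
have farS n m : (n <= m)%N -> far n `<=` far m.
  move=> nm x [Xx xF]; split=> // y Fy; apply: le_trans (xF y Fy).
  by rewrite lef_pV2 ?posrE// ler_nat ltnS.
have rho_le n : (rho n.+1 <= a n.+2 - a n)%R.
  rewrite lerBrDr -lee_fin EFinD !fineK//.
  apply: (@le_trans _ _ (H s (shell n.+1 `|` far n))); last first.
    by apply: le_hausdorff => x [[]//|]; apply: farS; rewrite -addn2 leq_addr.
  apply: (@hausdorff_separated s (n.+1%:R^-1 - n.+2%:R^-1)).
    by rewrite subr_gt0 ltf_pV2 ?posrE// ltr_nat.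
  move=> x z [[Xx _] xfar] [Xz zF].
  have /existsNP[y /not_implyP[Fy /negP]] :
      ~ forall y, F y -> (n.+2%:R^-1 <= edist x y)%R by move=> xF; apply: xfar.
  rewrite -ltNge => xy; have := zF y Fy.
  have := edist_triangle x z y; rewrite (edistC z x).
  by move: (n.+1%:R^-1)%R (n.+2%:R^-1)%R xy => p q; lra.
have sum_rho m n :
    (\sum_(k < n) rho (m + k).+1 <= a (m + n).+1 + a (m + n)%N - a m.+1 - a m)%R.
  elim: n => [|n IH]; first by rewrite big_ord0 addn0; lra.
  by rewrite big_ord_recr/= addnS; have := rho_le (m + n)%N; lra.
have sub_far : X `&` ~` F `<=` \bigcup_n far n.
  move=> x [Xx /(closed_edist_gt0 Fc)[r r0 rF]].
  have [N HN] := cvg0_lt (@cvg_harmonic R) r0.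
  exists N => //; split=> // y Fy; apply: le_trans (rF y Fy).
  have := HN N (leqnn N); rewrite /harmonic.
  by rewrite ger0_norm ?invr_ge0// => /ltW.
have split_far n : H s (X `&` F) + H s (far n) <= H s X.
  apply: (@le_trans _ _ (H s ((X `&` F) `|` far n))); last first.
    by apply: le_hausdorff => x [[]//|[]].
  apply: (@hausdorff_separated s n.+1%:R^-1); first by rewrite invr_gt0.
  by move=> x y [_ Fx] [_ yF]; rewrite edistC; exact: yF.
have XF_fin : H s (X `&` F) \is a fin_num by apply: fin => x [].
have XcF_fin : H s (X `&` ~` F) \is a fin_num by apply: fin => x [].
pose c := sup (range a).
have a_le n : (a n <= fine (H s X) - fine (H s (X `&` F)))%R.
  rewrite lerBrDl -lee_fin EFinD !fineK//; exact: fin.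
have a_ub : has_ubound (range a).
  by exists (fine (H s X) - fine (H s (X `&` F)))%R => _ [n _ <-].
have ac n : (a n <= c)%R by apply: ub_le_sup => //; exists n.
have c_le : (c <= fine (H s X) - fine (H s (X `&` F)))%R.
  by apply: ge_sup; [exists (a 0%N), 0%N|move=> _ [n _ <-]].
(* the shells beyond [far m.+1] add up to at most c + c - a m.+1 - a m *)
have h_le m : (fine (H s (X `&` ~` F)) <= c + c - a m)%R.
  rewrite -lee_fin fineK//.
  pose U k := if k is k'.+1 then shell (m + k').+1 else far m.+1.
  have XU : X `&` ~` F `<=` \bigcup_k U k.
    move=> x /sub_far[n _]; elim: n => [|n IH] xn.
      by exists 0%N => //; exact: farS xn.
    have [/IH//|xNn] := pselect (far n x).
    have [nm|mn] := leqP n.+1 m.+1; first by exists 0%N => //; exact: farS xn.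
    exists (n - m)%N => //; rewrite /U.
    rewrite ltnS in mn; case E : (n - m)%N => [|k].
      by move/eqP: E; rewrite subn_eq0 leqNgt mn.
    by rewrite -addnS -E subnKC// ltnW.
  apply: le_trans (le_hausdorff s XU) _.
  apply: le_trans (hausdorff_sigma_subadditive s U) _.
  apply: lime_le.
    by apply: is_cvg_nneseries => n _ _; exact: hausdorff_ge0.
  apply: nearW => -[|n]; rewrite ?big_mkord.
    rewrite big_ord0 lee_fin.
    have a_ge0 : (0 <= a m)%R by exact: fine_ge0 (hausdorff_ge0 _ _).
    by have := ac m; lra.
  rewrite big_ord_recl/=.
  have -> : \sum_(i < n) H s (shell (m + i).+1) = (\sum_(k < n) rho (m + k).+1)%:E.
    by rewrite -sumEFin; apply: eq_bigr => i _; rewrite fineK.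
  rewrite -(fineK (far_fin m.+1)) -EFinD lee_fin -/(a m.+1).
  have := sum_rho m n; have := ac (m + n)%N; have := ac (m + n).+1; lra.
have h_c : (fine (H s (X `&` ~` F)) <= c)%R.
  suff : (c <= c + c - fine (H s (X `&` ~` F)))%R by lra.
  apply: ge_sup; first by exists (a 0%N), 0%N.
  by move=> _ [n _ <-]; have := h_le n; lra.
rewrite -(fineK XF_fin) -(fineK XcF_fin) -(fineK (fin X _))// -EFinD lee_fin.
lra.
Qed.

Lemma diam_le (A : set V) (r : R) :
  (forall x y, A x -> A y -> (edist x y <= r)%R) -> diam A <= r%:E.
Proof.
by move=> Ar; apply: ge_ereal_sup => _ [[x y] [Ax Ay] <-]; rewrite lee_fin Ar.
Qed.

Lemma hausdorff_gauge_le s (A : set V) (r : R) : (0 <= r)%R ->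
  diam A <= r%:E ->
  hausdorff_gauge s A <= (ball_volume R s / 2 ^+ s * r ^+ s)%:E.
Proof.
move=> r0 Ar; have b0 := ball_volume_ge0 R s; rewrite /hausdorff_gauge.
case: eqP => [_|/eqP/set0P/diam_ge0 A0].
  by rewrite lee_fin !mulr_ge0 ?exprn_ge0 ?invr_ge0.
rewrite [leRHS]EFinM EFin_expe lee_pmul//.
- by rewrite lee_fin divr_ge0.
- exact: expe_ge0.
- move: (diam A) A0 Ar => x x0 xr; elim: s {b0} => // s IH.
  by rewrite !expeS lee_pmul// expe_ge0.
Qed.

End hausdorff_metric.

Section hyperplane.
Context (R : realType) (n : nat).
Local Notation V := 'rV[R]_n.+1.

(** A coordinate [i0] along which the normal [a] does not vanish is, on the
    hyperplane, a Lipschitz function of the other n coordinates. A grid of mesh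
    [h] in these cuts [A] into N^n cells of diameter at most [L * h], where
    [N * h] is the fixed side [2 * m] of a cube, so the sum of the gauges does not
    depend on [h]. *)
Lemma hausdorff_hyperplane (a : V) (c M : R) (A : set V) :
  a != 0 -> (forall x, A x -> dotv a x = c) ->
  (forall x i, A x -> `|x 0 i| <= M) ->
  (@hausdorff R n.+1 n A < +oo)%E.
Proof.
move=> a0 Ac AM.
have [i0 ai0] : exists i0, a 0 i0 != 0.
  apply: contrapT => /forallNP H; move/eqP: a0; apply; apply/rowP => i.
  by rewrite mxE; apply/eqP; rewrite -[_ == _]negbK; exact/negP.
pose m : R := `|M| + 1; have m0 : 0 < m by rewrite ltr_wpDl.
have Am x i : A x -> `|x 0 i| < m.
  move=> /AM/le_lt_trans; apply; rewrite /m.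
  by rewrite (le_lt_trans (ler_norm M))// ltrDl.
pose K : R := \sum_i `|a 0 i| / `|a 0 i0|.
have K1 : 1 <= K.
  rewrite /K (bigD1 i0)//= divff ?normr_eq0// lerDl.
  by apply: sumr_ge0 => i _; rewrite divr_ge0.
pose L : R := n.+1%:R * K; have L0 : 0 < L.
  by rewrite mulr_gt0// (lt_le_trans ltr01).
have Lip (h : R) x y : 0 <= h -> A x -> A y ->
    (forall j, `|x 0 (lift i0 j) - y 0 (lift i0 j)| <= h) -> edist x y <= L * h.
  move=> h0 Ax Ay xy.
  apply: le_trans (edist_le_norm x y) _; rewrite -mulrA ler_wpM2l//.
  have Kh : h <= K * h by rewrite ler_peMl.
  have K0 : 0 <= K * h by rewrite (le_trans h0).
  rewrite [leLHS]/Num.norm/= mx_normrE; apply/bigmax_leP; split=> // -[i j] _ /=.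
  rewrite !mxE ord1; have [j' ->|->] := unliftP i0 j; first exact: le_trans Kh.
  have : a 0 i0 * (x 0 i0 - y 0 i0) =
      - \sum_(i | i != i0) a 0 i * (x 0 i - y 0 i).
    have : \sum_i a 0 i * (x 0 i - y 0 i) = 0.
      under eq_bigr do rewrite mulrBr.
      rewrite sumrB; have := Ac x Ax; have := Ac y Ay.
      by rewrite /dotv => -> ->; rewrite subrr.
    by rewrite (bigD1 i0)//= => /eqP; rewrite addr_eq0 => /eqP.
  move/(congr1 Num.norm); rewrite normrM normrN => E.
  have a0' : 0 < `|a 0 i0| by rewrite normr_gt0.
  rewrite -(ler_pM2l a0') E (le_trans (ler_norm_sum _ _ _))//.
  rewrite /K mulrA mulr_sumr mulr_suml [leRHS](bigD1 i0)//=.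
  rewrite -[leLHS]add0r lerD//.
    by rewrite !mulr_ge0 ?invr_ge0.
  apply: ler_sum => l; rewrite eq_sym => /unlift_some[k -> _].
  rewrite normrM mulrCA divff ?normr_eq0// mulr1.
  by rewrite ler_wpM2l.
apply: (@le_lt_trans _ _ (ball_volume R n / 2 ^+ n * (L * (2 * m)) ^+ n)%:E);
  last exact: ltry.
apply: ge_ereal_sup => _ [delta /= d0 <-].
(* fine enough for the cells to have diameter at most delta *)
pose N := (Num.truncn (L * (2 * m) / delta)).+1.
have N0 : 0 < N%:R :> R by rewrite ltr0n.
pose h : R := 2 * m / N%:R; have h0 : 0 < h by rewrite divr_gt0// mulr_gt0.
have Lh : L * h <= delta.
  rewrite /h mulrA ler_pdivrMr// [leRHS]mulrC -ler_pdivrMr//.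
  exact/ltW/truncnS_gt.
pose cell (k : {ffun 'I_n -> 'I_N}) : set V := A `&` [set x |
  forall j, (k j)%:R * h <= x 0 (lift i0 j) + m <= (k j).+1%:R * h].
have celld k : (diam (cell k) <= (L * h)%:E)%E.
  apply: diam_le => x y [Ax xk] [Ay yk]; apply: Lip => //; first exact: ltW.
  move=> j; have := xk j; have := yk j; rewrite -natr1 mulrDl mul1r.
  by rewrite ler_norml; lra.
pose T := #|{ffun 'I_n -> 'I_N}|.
pose F k : set V := if insub k is Some i then cell (@enum_val _ predT i) else set0.
have Fd k : (diam (F k) <= (L * h)%:E)%E.
  by rewrite /F; case: insubP => [i _ _|_]; [exact: celld|rewrite diam0 leNye].
apply: (@le_trans _ _ (\sum_(k <oo) hausdorff_gauge n (F k))%E).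
  apply: ereal_inf_lbound; exists F => //; split=> [k|x Ax].
    by rewrite (le_trans (Fd k))// lee_fin.
  have tN (j : 'I_n) : (Num.truncn ((x 0 (lift i0 j) + m) / h)%R < N)%N.
    have := Am x (lift i0 j) Ax; rewrite ltr_norml => /andP[xm1 xm2].
    rewrite -(ltr_nat R) (@le_lt_trans _ _ ((x 0 (lift i0 j) + m) / h))//.
      by rewrite truncn_le// divr_ge0 ?ltW//; lra.
    by rewrite ltr_pdivrMr// /h mulrCA divff ?gt_eqF// mulr1; lra.
  pose k : {ffun 'I_n -> 'I_N} := [ffun j => Ordinal (tN j)].
  exists (enum_rank k) => //; rewrite /F.
  case: insubP => [i _ ik|]; last by rewrite ltn_ord.
  have -> : i = enum_rank k by exact: val_inj.
  rewrite enum_rankK; split=> // j; rewrite ffunE /=.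
  have := Am x (lift i0 j) Ax; rewrite ltr_norml => /andP[xm1 xm2].
  apply/andP; split; last by rewrite -ler_pdivrMr//; exact/ltW/truncnS_gt.
  by rewrite -ler_pdivlMr// truncn_le divr_ge0 ?ltW//; lra.
rewrite (nneseries_split 0 T); last by move=> k _; exact: hausdorff_gauge_ge0.
rewrite add0n [X in (_ + X)%E]eseries0 ?adde0; last first.
  move=> k Tk _; rewrite /F insubF ?hausdorff_gauge0//.
  by apply/negbTE; rewrite -leqNgt.
rewrite big_mkord.
apply: (@le_trans _ _ (\sum_(k < T) (ball_volume R n / 2 ^+ n * (L * h) ^+ n)%:E)%E).
  apply: lee_sum => k _; apply: hausdorff_gauge_le (Fd k).
  by rewrite mulr_ge0 ?ltW.
rewrite sumEFin sumr_const card_ord lee_fin /T card_ffun !card_ord.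
rewrite -[leLHS]mulr_natr natrX.
have -> : L * (2 * m) = L * h * N%:R by rewrite /h -!mulrA mulVf ?mulr1// gt_eqF.
by rewrite [(L * h * _) ^+ n]exprMn !mulrA.
Qed.

End hyperplane.

(** * Integral operators on families of square-integrable functions *)

Lemma Rintegral_sum dd (T : measurableType dd) (R : realType)
    (mu : {measure set T -> \bar R}) (D : set T) (I : eqType) (s : seq I)
    (f : I -> T -> R) : measurable D ->
  {in s, forall i, mu.-integrable D (EFin \o f i)} ->
  mu.-integrable D (EFin \o (fun x => \sum_(i <- s) f i x)) /\
  \int[mu]_(x in D) \sum_(i <- s) f i x = \sum_(i <- s) \int[mu]_(x in D) f i x.
Proof.
move=> mD; elim: s => [_|i s IH fs].
  split; first by apply: eq_integrable (integrable0 _ _) => // x _ /=; rewrite big_nil.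
  rewrite big_nil (@eq_Rintegral _ _ _ _ _ (fun=> 0)) ?Rintegral_cst ?mul0r//.
  by move=> x _; rewrite big_nil.
have fi := fs i (mem_head _ _).
have [|is_ IHs] := IH; first by move=> j js; apply: fs; rewrite in_cons js orbT.
split; first by apply: eq_integrable (integrableD mD fi is_) => // x _ /=; rewrite big_cons.
rewrite big_cons -IHs -RintegralD//.
by apply: eq_Rintegral => x _; rewrite big_cons.
Qed.

Section Lfun2.
Context dd (T : measurableType dd) (R : realType).
Context (mu : {measure set T -> \bar R}).
Implicit Types f g : T -> R.

Lemma integrable_sqr_Lfun2 f : measurable_fun setT f ->
  mu.-integrable setT (EFin \o (fun x => f x ^+ 2)) -> f \in Lfun mu 2%:E.
Proof.
move=> mf /integrableP[_ if2]; rewrite inE; apply/andP; split; rewrite inE//=.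
rewrite /finite_norm (@lty_poweRy _ _ 2)// powR_Lnorm//.
apply: le_lt_trans if2; rewrite ge0_le_integral//.
- by move=> x _; exact: poweR_ge0.
- have mg : measurable_fun setT (fun x => `|(f x)%:E|%E).
    by apply: measurableT_comp => //; exact/measurable_EFinP.
  have := measurableT_comp (@measurable_poweR R 2) mg; exact.
- apply: measurableT_comp => //; apply/measurable_EFinP; exact: measurable_funX.
- by move=> x _ /=; rewrite lee_fin powR_mulrn// normrX.
Qed.

Section restricted.
Context (E : set T).
Hypothesis mE : measurable E.

Lemma Lfun2_measurable f : f \_ E \in Lfun mu 2%:E -> measurable_fun E f.
Proof.
move=> /sub_Lfun_mfun; rewrite inE/= => mf; exact/(measurable_restrictT _ mE).
Qed.

Lemma Lfun2_integrableM f g : f \_ E \in Lfun mu 2%:E ->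
  g \_ E \in Lfun mu 2%:E -> mu.-integrable E (EFin \o (fun x => f x * g x)).
Proof.
move=> f2 g2; apply/integrable_mkcond => //.
have /Lfun1_integrable := Lfun2_mul_Lfun1 f2 g2.
apply: eq_integrable => // x _ /=; rewrite !patchE.
by case: ifPn => //; rewrite mulr0.
Qed.

Lemma bounded_Lfun2 f (C : R) : (mu E < +oo)%E -> measurable_fun E f ->
  (forall x, E x -> `|f x| <= C) -> f \_ E \in Lfun mu 2%:E.
Proof.
move=> Efin mf fC; apply: integrable_sqr_Lfun2.
  exact/(measurable_restrictT _ mE).
have -> : EFin \o (fun x => (f \_ E) x ^+ 2) = (EFin \o (fun x => f x ^+ 2)) \_ E.
  by apply/funext => x; rewrite /= !patchE; case: ifPn => //; rewrite expr0n.
apply: (iffLR (integrable_mkcond _ mE)); apply: measurable_bounded_integrable => //.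
  exact: measurable_funX.
exists (C ^+ 2); split; first by rewrite num_real.
move=> M CM x Ex /=; rewrite (le_trans _ (ltW CM))// normrX.
by rewrite lerXn2r ?nnegrE ?fC// (le_trans _ (fC x Ex)).
Qed.

End restricted.
End Lfun2.

Section L2_families.
Context dd (T : measurableType dd) (R : realType).
Context (mu : {measure set T -> \bar R}) (n : nat) (E : 'I_n -> set T).
Hypothesis mE : forall i, measurable (E i).
Local Notation W := ('I_n -> T -> R).
Implicit Types u v : W.

Definition L2_families : set W := [set u | forall i, u i \_ (E i) \in Lfun mu 2%:E].

Definition families_dot u v : R :=
  \sum_(i < n) \int[mu]_(x in E i) (u i x * v i x).

Local Notation X := L2_families.
Local Notation dot := families_dot.

Lemma L2_semi_inner : semi_inner X dot.
Proof.
have two : (1 <= 2%:E :> \bar R)%E by rewrite lee_fin ler1n.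
split.
- move=> i; rewrite (_ : _ \_ _ = 0); last first.
    by apply/funext => x; rewrite patchE; case: ifP.
  exact: (Lfun_submod_closed mu two).1.
- move=> a u v Xu Xv i.
  have -> : (a *: u + v) i \_ (E i) = a *: (u i \_ (E i)) + (v i \_ (E i)).
    apply/funext => x; rewrite patchE.
    rewrite -[RHS]/(a * (u i \_ (E i)) x + (v i \_ (E i)) x) !patchE.
    by case: ifP => // _; rewrite mulr0 addr0.
  exact: (Lfun_submod_closed mu two).2.
- by move=> u v _ _; apply: eq_bigr => i _; apply: eq_Rintegral => x _; rewrite mulrC.
- move=> a u v w Xu Xv Xw; rewrite /dot mulr_sumr -big_split; apply: eq_bigr => i _ /=.
  have iu := Lfun2_integrableM (mE i) (Xu i) (Xw i).
  have iv := Lfun2_integrableM (mE i) (Xv i) (Xw i).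
  rewrite -RintegralZl// -RintegralD//.
    apply: eq_Rintegral => x _.
    by rewrite -[(a *: u + v) i x]/(a * u i x + v i x) mulrDl mulrA.
  have := integrableZl (mE i) a iu; exact: eq_integrable.
- move=> u Xu; apply: sumr_ge0 => i _; apply: Rintegral_ge0 => x _.
  by rewrite -expr2 sqr_ge0.
Qed.

Hypothesis fE : forall i, (mu (E i) < +oo)%E.

Definition total_mass : R := \sum_(i < n) fine (mu (E i)).

Lemma total_mass_ge0 : 0 <= total_mass.
Proof. by apply: sumr_ge0 => i _; exact: fine_ge0. Qed.

Lemma sum_integral_le (f : 'I_n -> T -> R) (C : R) :
  (forall i, mu.-integrable (E i) (EFin \o f i)) ->
  (forall i x, E i x -> f i x <= C) ->
  \sum_(i < n) \int[mu]_(x in E i) f i x <= C * total_mass.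
Proof.
move=> fi fC; rewrite /total_mass mulr_sumr; apply: ler_sum => i _.
rewrite -Rintegral_cst//; apply: le_Rintegral => //; last exact: fC.
apply: measurable_bounded_integrable => //.
exists `|C|; split; first by rewrite num_real.
by move=> M CM x _ /=; exact: ltW.
Qed.

Lemma sup_le_nrm u (e : R) : 0 <= e -> X u ->
  (forall i x, E i x -> `|u i x| <= e) -> nrm dot u ^+ 2 <= e ^+ 2 * total_mass.
Proof.
move=> e0 Xu ue; rewrite (sqr_nrm L2_semi_inner)//.
apply: sum_integral_le => [i|i x Ex]; first exact: Lfun2_integrableM.
by rewrite -expr2 -[_ ^+ 2]real_normK ?num_real// lerXn2r ?nnegrE// ue.
Qed.

Section kernel_operator.
Context (kap : 'I_n -> T -> W) (C : R) (K : W -> W).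
Hypothesis kapX : forall i x, E i x -> X (kap i x).
Hypothesis kapC : forall i x, E i x -> nrm dot (kap i x) <= C.
Hypothesis KE : forall u, X u -> forall i x, E i x -> K u i x = dot (kap i x) u.
Hypothesis Kmeas : forall u, X u -> forall i, measurable_fun (E i) (K u i).

Let C0 : 0 <= `|C|. Proof. exact: normr_ge0. Qed.
Let kapC' i x : E i x -> nrm dot (kap i x) <= `|C|.
Proof. by move=> /kapC/le_trans; apply; exact: ler_norm. Qed.

Lemma kernel_operator_le u : X u -> forall i x, E i x ->
  `|K u i x| <= `|C| * nrm dot u.
Proof.
move=> Xu i x Ex; rewrite KE//.
apply: le_trans (cauchy_schwarz L2_semi_inner (kapX Ex) Xu) _.
by rewrite ler_wpM2r ?kapC'// sqrtr_ge0.
Qed.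

Lemma kernel_operator_mem u : X u -> X (K u).
Proof.
move=> Xu i; apply: (@bounded_Lfun2 _ _ _ _ _ _ _ (`|C| * nrm dot u)) => //.
  exact: Kmeas.
exact: kernel_operator_le.
Qed.

Lemma eqv_families u v : (forall i x, E i x -> u i x = v i x) -> eqv dot u v.
Proof.
move=> uv; rewrite /eqv /nrm /families_dot big1 ?sqrtr0// => i _.
rewrite (@eq_Rintegral _ _ _ _ _ (fun=> 0)) ?Rintegral_cst ?mul0r// => x.
rewrite inE => Ex; rewrite -[(u - v) i x]/(u i x - v i x) uv// subrr.
by rewrite mulr0.
Qed.

Lemma kernel_operator_bounded : bounded_operator X dot K.
Proof.
split; first exact: kernel_operator_mem.
  move=> a u v Xu Xv; apply: eqv_families => i x Ex.
  rewrite -[RHS]/(a * K u i x + K v i x) !KE//; last exact: (subL L2_semi_inner).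
  have Xk := kapX Ex; have Xau := memZ L2_semi_inner a Xu.
  by rewrite (dotDr L2_semi_inner)// (dotZr L2_semi_inner).
exists (Num.sqrt (`|C| ^+ 2 * total_mass)) => u Xu.
rewrite -(@ler_pXn2r _ 2)// ?nnegrE ?mulr_ge0 ?sqrtr_ge0//.
rewrite exprMn [Num.sqrt (_ * _) ^+ 2]sqr_sqrtr ?mulr_ge0 ?sqr_ge0 ?total_mass_ge0//.
rewrite mulrAC -exprMn; apply: sup_le_nrm.
- by rewrite mulr_ge0// sqrtr_ge0.
- exact: kernel_operator_mem.
- exact: kernel_operator_le.
Qed.

(** For fixed [x], Bessel's inequality bounds the sum of [(K e i x) ^+ 2] over
    orthonormal vectors [e] by the squared norm of [kap i x], hence by [C ^+ 2];
    integrating this over [x] costs the finite total mass. *)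
Lemma kernel_operator_hilbert_schmidt : hilbert_schmidt X dot K.
Proof.
split; first exact: kernel_operator_bounded.
have [B Bbasis] := orthonormal_basis_exists L2_semi_inner.
exists B => //; have [BX Bo _] := Bbasis.
apply: (@le_lt_trans _ _ (`|C| ^+ 2 * total_mass)%:E); last exact: ltry.
apply: ge_ereal_sup => _ [F [Ffin FB] <-].
have [s0 Fs0] := (finite_seqP F).1 Ffin; pose fs := undup s0.
have Ffs : F = [set` fs].
  by rewrite Fs0; apply/seteqP; split=> e /=; rewrite mem_undup.
rewrite Ffs -fsbig_seq ?undup_uniq// sumEFin lee_fin.
have Fin : {in fs, forall e, B e} by move=> e efs; apply: FB; rewrite Ffs.
under eq_big_seq => e eF.
  have Xe : X e by exact/BX/Fin.
  rewrite (sqr_nrm L2_semi_inner); last exact: kernel_operator_mem.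
  over.
rewrite exchange_big /=.
have int e i : e \in fs -> mu.-integrable (E i) (EFin \o (fun x => K e i x * K e i x)).
  move=> eF; have XKe : X (K e) by apply/kernel_operator_mem/BX/Fin.
  exact: Lfun2_integrableM.
have sumE i := Rintegral_sum (mE i) (fun e efs => int e i efs).
rewrite (eq_bigr (fun i => \int[mu]_(x in E i)
    \sum_(e <- fs) (K e i x * K e i x))); last first.
  by move=> i _; have [_ ->] := sumE i.
apply: sum_integral_le => [i|i x Ex]; first by have [] := sumE i.
apply: (@le_trans _ _ (dot (kap i x) (kap i x))).
  apply: le_trans (bessel L2_semi_inner _ (kapX Ex) (undup_uniq s0) Fin) => //.
  rewrite le_eqVlt; apply/orP; left; apply/eqP; apply: eq_big_seq => e /Fin/BX Xe.
  by rewrite KE// expr2.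
rewrite -(sqr_nrm L2_semi_inner); last exact: kapX.
by rewrite lerXn2r ?nnegrE ?sqrtr_ge0 ?kapC'.
Qed.

(** Along an ultrafilter finer than [\oo], the bounded real sequence
    [K (u m) i x] converges for every [x]. The functions [K (u m) i] vary by at
    most [e * B] between points whose kernels are [e]-close, so the finite nets
    make this convergence uniform. The members of the ultrafilter are infinite,
    which yields a subsequence converging uniformly, hence in norm. *)
Lemma kernel_operator_compact :
  (forall i (e : R), 0 < e -> exists s : seq T, {in s, forall y, E i y} /\
    forall x, E i x -> exists2 y, y \in s & nrm dot (kap i x - kap i y) <= e) ->
  compact_operator X dot K.
Proof.
move=> net; split; first exact: kernel_operator_bounded.
move=> u Xu [B0 uB0]; pose B := `|B0| + 1.
have B_gt0 : 0 < B by rewrite ltr_wpDl.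
have uB n' : nrm dot (u n') <= B.
  by rewrite (le_trans (uB0 n'))// (le_trans (ler_norm _))// lerDl.
pose D := `|C| * B; have D0 : 0 <= D by rewrite mulr_ge0// ltW.
have aD m i x : E i x -> `|K (u m) i x| <= D.
  move=> Ex; apply: le_trans (kernel_operator_le (Xu m) Ex) _.
  by rewrite ler_wpM2l.
have [U [UU ooU]] := ultraFilterLemma (F := \oo%classic) _.
have /choice[w0 w0P] (p : 'I_n * T) : exists l : R, E p.1 p.2 ->
    K (u m) p.1 p.2 @[m --> U] --> l.
  have [Ex|] := pselect (E p.1 p.2); last by exists 0.
  have [|l [_ lU]] := @segment_compact R (- D) D
      (K (u m) p.1 p.2 @[m --> U]) _.
    change (U ((fun m => K (u m) p.1 p.2) @^-1` `[- D, D])).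
    apply: filterS filterT => m _ /=; rewrite in_itv/=.
    by have := aD m _ _ Ex; rewrite ler_norml.
  exists l => _ A lA.
  have [//|UnA] := in_ultra_setVsetC ((fun m => K (u m) p.1 p.2) @^-1` A) UU.
  by have [x []] := lU (~` A) A UnA lA.
pose w i x := w0 (i, x).
have wP i x : E i x -> K (u m) i x @[m --> U] --> w i x by exact: (w0P (i, x)).
have near_w i x (e : R) : 0 < e -> E i x ->
    \forall m \near U, `|K (u m) i x - w i x| <= e.
  by move=> e0 /wP/cvgrPdist_le/(_ e e0); apply: filterS => m; rewrite distrC.
have lip i x y m (e : R) : E i x -> E i y -> nrm dot (kap i x - kap i y) <= e ->
    `|K (u m) i x - K (u m) i y| <= e * B.
  move=> Ex Ey xy; have [Xx Xy] := (kapX Ex, kapX Ey).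
  have Xxy := memB L2_semi_inner Xx Xy.
  rewrite !KE// -(dotNl L2_semi_inner)// -(dotDl L2_semi_inner)//;
    last exact: (memN L2_semi_inner).
  apply: le_trans (cauchy_schwarz L2_semi_inner Xxy (Xu m)) _.
  by rewrite ler_pM// sqrtr_ge0.
have unif i (e : R) : 0 < e ->
    \forall m \near U, forall x, E i x -> `|K (u m) i x - w i x| <= e.
  move=> e0; have e5 : 0 < e / 5 by rewrite divr_gt0.
  have [s [sE sn]] := net i (e / 5 / B) (divr_gt0 e5 B_gt0).
  have near_s : \forall m \near U, {in s, forall y, `|K (u m) i y - w i y| <= e / 5}.
    elim: s sE {sn} => [_|y s IH sE]; first exact: filterS filterT.
    have /IH {}IH : {in s, forall y, E i y}.
      by move=> z zs; apply: sE; rewrite in_cons zs orbT.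
    have near_y := near_w i y _ e5 (sE _ (mem_head _ _)).
    apply: filterS (filterI near_y IH) => m [my ms] z.
    by rewrite in_cons => /predU1P[->//|/ms].
  apply: filterS near_s => m ms x Ex.
  have [y ys xy] := sn x Ex; have Ey := sE y ys.
  have [m' [m'x m'y]] := filter_ex (filterI (near_w i x _ e5 Ex) (near_w i y _ e5 Ey)).
  have := lip i x y m _ Ex Ey xy; have := lip i x y m' _ Ex Ey xy.
  rewrite divfK ?gt_eqF//; have := ms y ys.
  move: m'x m'y; rewrite !ler_norml => /andP[? ?] /andP[? ?] /andP[? ?] /andP[? ?] /andP[? ?].
  by apply/andP; split; lra.
have /choice[g gP] (p : nat * nat) : exists m, (p.1 < m)%N /\
    forall i x, E i x -> `|K (u m) i x - w i x| <= p.2.+1%:R^-1.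
  have h1 : \forall m \near U, (p.1 < m)%N by apply: ooU; exact: nbhs_infty_gt.
  have h2 : \forall m \near U, forall i x, E i x ->
      `|K (u m) i x - w i x| <= p.2.+1%:R^-1.
    by apply: filter_forall => i; apply: unif; rewrite invr_gt0.
  by have [m [? ?]] := filter_ex (filterI h1 h2); exists m.
pose s := fix s m := if m is m'.+1 then g (s m', m) else g (0%N, 0%N).
have sP m i x : E i x -> `|K (u (s m)) i x - w i x| <= m.+1%:R^-1.
  by case: m => [|m] Ex; exact: (gP (_, _)).2.
have Xw : X w.
  move=> i; apply: (@bounded_Lfun2 _ _ _ _ _ _ _ (D + 1)) => //.
    apply: (@measurable_fun_cvg _ _ _ _ (fun m => K (u (s m)) i)) => [m|x Ex].
      exact: Kmeas.
    apply/cvgrPdist_le => e e0; have [N HN] := cvg0_lt (@cvg_harmonic R) e0.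
    exists N => // m /= /HN mN; rewrite distrC (le_trans (sP m _ _ Ex))//.
    exact: le_trans (ler_norm _) (ltW mN).
  move=> x Ex; have := sP 0%N i x Ex; have := aD (s 0%N) i x Ex.
  rewrite invr1 !ler_norml => /andP[? ?] /andP[? ?].
  by apply/andP; split; lra.
exists s, w; split=> //.
  by apply: homo_ltn => [m1 m2 m3|m]; [exact: ltn_trans|exact: (gP (_, _)).1].
pose M := Num.sqrt total_mass.
apply: (@squeeze_cvgr _ _ _ _ (fun=> 0) (fun m => harmonic m * M)).
- apply: nearW => m; rewrite sqrtr_ge0/=.
  rewrite -(@ler_pXn2r _ 2)// ?nnegrE ?mulr_ge0 ?sqrtr_ge0 ?invr_ge0//.
  rewrite exprMn [M ^+ 2]sqr_sqrtr ?total_mass_ge0//.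
  apply: sup_le_nrm; [by rewrite invr_ge0| |exact: sP].
  by apply: (memB L2_semi_inner) => //; exact: kernel_operator_mem.
- exact: cvg_cst.
- by rewrite -(mul0r M); apply: cvgM; [exact: cvg_harmonic|exact: cvg_cst].
Qed.

End kernel_operator.

End L2_families.

(** * Continuous kernels on compact sets *)

Section within.
Context (R : realType).

Lemma within_contP (T : topologicalType) (S : set T) (f : T -> R) :
  {within S, continuous f} <-> forall x, S x -> forall e : R, 0 < e ->
    \forall y \near x, S y -> `|f x - f y| <= e.
Proof.
rewrite subspace_continuousP; split=> [cf x Sx e e0|cf x Sx].
  by have /cvgrPdist_le/(_ e e0) := cf x Sx.
by apply/cvgrPdist_le => e e0; exact: (cf x Sx e e0).
Qed.

Lemma within_closed_preimage (T : topologicalType) (S : set T) (f : T -> R) (B : set R) :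
  closed S -> {within S, continuous f} -> closed B -> closed (S `&` f @^-1` B).
Proof.
move=> Sc /continuous_closedP cf /cf/closed_subspaceP[F Fc FE].
by rewrite setIC -FE; exact: closedI.
Qed.

Section kernel.
Context (U : ptopologicalType) (V : topologicalType).
Context (A : set U) (B : set V) (g : U -> V -> R).
Hypothesis Ac : compact A.
Hypothesis Bc : compact B.
Hypothesis cg : {within A `*` B, continuous (fun p => g p.1 p.2)}.

Lemma kernel_bounded : exists C : R, forall x y, A x -> B y -> `|g x y| <= C.
Proof.
have := continuous_compact cg (compact_setX Ac Bc).
move=> /compact_bounded[M [_ HM]]; exists (M + 1) => x y Ax By.
by apply: (HM (M + 1)); [rewrite ltrDl|exists (x, y)].
Qed.

Lemma kernel_section x : A x -> {within B, continuous (g x)}.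
Proof.
move=> Ax; apply/within_contP => y By e e0.
have := (within_contP _ _).1 cg (x, y) (conj Ax By) e e0.
case=> -[P Q] /= [xP yQ] PQ.
apply: filterS yQ => z Qz Bz; apply: (PQ (x, z)) => //.
by split=> //; exact: nbhs_singleton.
Qed.

(** The tube lemma: compactness of [B] makes one neighbourhood of [x] serve all
    [y] at once. *)
Lemma kernel_equicontinuous x (e : R) : A x -> 0 < e ->
  \forall x' \near x, A x' -> forall y, B y -> `|g x y - g x' y| <= e.
Proof.
move=> Ax e0; have e2 : 0 < e / 2 by rewrite divr_gt0.
have := (compact_near_coveringP B).1 Bc _ (nbhs x)
  (fun x' y => A x' -> B y -> `|g x y - g x' y| <= e) _.
have H y : B y -> \forall y' \near y & x' \near x, A x' -> B y' -> `|g x y' - g x' y'| <= e.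
  move=> By; have := (within_contP _ _).1 cg (x, y) (conj Ax By) _ e2.
  case=> -[P Q] /= [xP yQ] PQ; exists (Q, P) => // -[y' x'] /= [Qy' Px'] Ax' By'.
  have h1 := PQ (x', y') (conj Px' Qy') (conj Ax' By').
  have h2 := PQ (x, y') (conj (nbhs_singleton xP) Qy') (conj Ax By').
  move: h1 h2; rewrite !ler_norml /= => /andP[? ?] /andP[? ?].
  by apply/andP; split; lra.
by move=> /(_ _ H); apply: filterS => x' h Ax' y By; exact: h.
Qed.

Lemma kernel_net (e : R) : 0 < e -> exists s : seq U, {in s, forall x, A x} /\
  forall x, A x -> exists2 x', x' \in s & forall y, B y -> `|g x' y - g x y| <= e.
Proof.
move=> e0.
pose O x := [set x' | A x' -> forall y, B y -> `|g x y - g x' y| <= e]°.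
have AO : A `<=` cover A O.
  by move=> x Ax; exists x => //; exact: kernel_equicontinuous.
have := Ac; rewrite compact_cover => /(_ U A O (fun _ _ => open_interior _) AO).
case=> D DA Acov; exists (finmap.enum_fset D); split=> [x /DA|x Ax].
  by rewrite inE.
have [x' Dx' Ox'] := Acov x Ax; exists x' => //.
exact: (interior_subset Ox').
Qed.

End kernel.
End within.

(** * Geometry of the slabs *)

Section surface_measurability.
Context (R : realType) (d : nat).
Local Notation V := 'rV[R]_d.
Local Notation T := (caratheodory_type (surface_outer R d)).

Lemma closed_surface_measurable (F : set V) : closed F -> measurable (F : set T).
Proof. exact: closed_caratheodory. Qed.

Lemma within_surface_measurable (F : set V) (f : V -> R) : closed F ->
  {within F, continuous f} -> measurable_fun (F : set T) (f : T -> R).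
Proof.
move=> Fc cf; apply: (measurability (@RGenCInfty.G R)) => [|/= _ [_] [r] -> <-].
  exact: RGenCInfty.measurableE.
apply: closed_surface_measurable; apply: within_closed_preimage => //.
exact: rray_closed.
Qed.

End surface_measurability.

Section slab_geometry.
Context (R : realType) (d : nat) (P : slabs R d).
Hypothesis P_slabs : slab_decomposition P.
Local Notation V := 'rV[R]_d.
Local Notation height := (dotv (axis P)).

Lemma dotv_continuous (a : V) : continuous (dotv a : V -> R).
Proof.
rewrite /dotv; apply: continuous_big => [|i _].
  exact: add_continuous.
by move=> x; exact: (cvgM (cvg_cst (a 0 i)) (@coord_continuous R 1 d 0 i x)).
Qed.

Lemma heightD x t : height (x + t *: axis P) = height x + t.
Proof.
have [_ a1 _ _] := P_slabs.
have S := dotv_semi_inner R d.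
by rewrite (dotDr S)// (dotZr S)// a1 mulr1.
Qed.

Lemma level_lt k l : (level P k < level P l) = (k < l)%N.
Proof.
have [_ _ h0 _] := P_slabs.
by rewrite /level ltrD2l ltr_pM2r// ltr_nat.
Qed.

Lemma between_open k l : open (between P k l).
Proof.
have [[Oo _ _] _ _ _] := P_slabs.
apply: openI => //.
apply: (open_comp (f := height) (D := [set t | level P k < t < level P l])).
  by move=> x _; exact: dotv_continuous.
exact: (@interval_open R (BRight (level P k)) (BLeft (level P l))).
Qed.

Lemma interface_closed k : closed (interface P k).
Proof. exact: closed_closure. Qed.

Lemma interface_height k x : interface P k x -> height x = level P k.
Proof.
suff : interface P k `<=` height @^-1` [set level P k] by apply.
have /closure_id -> : closed (height @^-1` [set level P k]).
  by apply: closed_comp; [move=> y _; exact: dotv_continuous|exact: closed_eq].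
by apply: closureS => y [].
Qed.

Lemma slab_bounded : exists M : R, forall x, closure (domain P) x -> `|x| <= M.
Proof.
have [[_ _ [M [_ HM]]] _ _ _] := P_slabs.
exists (M + 1); suff : closure (domain P) `<=` [set x | `|x| <= M + 1] by apply.
have Mc : closed ((fun x : V => `|x|) @^-1` [set t | t <= M + 1]).
  by apply: closed_comp; [move=> y _; exact: norm_continuous|exact: closed_le].
rewrite [X in _ `<=` X]((closure_id _).1 Mc).
by apply: closureS => y Py; apply: HM => //; rewrite ltrDl.
Qed.

Lemma interface_compact k : compact (interface P k).
Proof.
apply: bounded_closed_compact; last exact: interface_closed.
have [M HM] := slab_bounded; exists M; split; first exact: num_real.
move=> N MN x Ix; apply: le_trans (ltW MN); apply: HM.
by apply: closureS Ix => y [].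
Qed.

Lemma interface_finite k : (0 < d)%N -> (surface R d (interface P k) < +oo)%E.
Proof.
move=> d0; have [M HM] := slab_bounded.
have a0 : axis P != 0.
  have [_ a1 _ _] := P_slabs; apply/eqP => a0; move: a1.
  rewrite a0 (dot0l (dotv_semi_inner R d))// => /eqP.
  by rewrite eq_sym oner_eq0.
have Ic x i : interface P k x -> `|x 0 i| <= M.
  move=> Ix; apply: le_trans (coord_le_norm x i) _; apply: HM.
  by apply: closureS Ix => y [].
have Ih := @interface_height k.
move: (axis P) (interface P k) (level P k) a0 Ih Ic; clear -d0.
case: d d0 => // n _ a A c a0 Ah AM.
exact: (@hausdorff_hyperplane R n a c M A).
Qed.

Lemma interface_sub_closure k l m : (k < l < m)%N ->
  interface P l `<=` closure (between P k m).
Proof.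
move=> /andP[kl lm]; apply: closureS => x [Px xl]; split=> //=.
by rewrite xl !level_lt kl.
Qed.

(** [s] is the sign of the shift: [1] moves up the axis and [-1] down. *)
Lemma axis_shift (x : V) (N : set V) (s e : R) : nbhs x N -> 0 < e ->
  exists t, [/\ 0 < t, t < e & N (x + (s * t) *: axis P)].
Proof.
move=> xN e0.
have c : x + (s * t) *: axis P @[t --> (0 : R)] --> x + (s * 0) *: axis P.
  apply: cvgD; first exact: cvg_cst.
  by apply: cvgZr_tmp; apply: cvgM; [exact: cvg_cst|exact: cvg_id].
rewrite mulr0 scale0r addr0 in c.
have /nbhs_ballP[r /= r0 rN] := c _ xN.
pose t := Num.min r e / 2.
have m0 : 0 < Num.min r e by rewrite lt_min r0.
have t0 : 0 < t by rewrite divr_gt0.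
have tm : t < Num.min r e by rewrite ltr_pdivrMr// ltr_pMr// ltr1n.
move: (tm); rewrite lt_min => /andP[tr te].
exists t; split=> //; apply: rN.
by rewrite -ball_normE/= sub0r normrN gtr0_norm.
Qed.

Lemma boundary_closed (A : set V) : closed (boundary A).
Proof.
by apply: closedI; [exact: closed_closure|exact/open_closedC/open_interior].
Qed.

Lemma boundary_open (A : set V) : open A -> boundary A = closure A `\` A.
Proof. by rewrite /boundary => /interior_id ->. Qed.

(** A point of the domain at the lower (upper) level enters the open slab when it
    is pushed slightly up (down) the axis. *)
Lemma interface_sub_boundary k l : (k < l)%N ->
  interface P k `<=` boundary (between P k l) /\
  interface P l `<=` boundary (between P k l).
Proof.
have [[Oo _ _] _ _ _] := P_slabs; move=> kl.
have lkl : 0 < level P l - level P k by rewrite subr_gt0 level_lt.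
split.
  have /closure_id -> := @boundary_closed (between P k l).
  apply: closureS => x [Px xk].
  rewrite (boundary_open (@between_open k l)); split; last first.
    by case=> _ /=; rewrite xk ltxx.
  move=> N xN.
  have [|t [t0 tl [Nt Pt]]] := @axis_shift x (N `&` domain P) 1 _ _ lkl.
    by apply: filterI => //; exact: open_nbhs_nbhs.
  exists (x + (1 * t) *: axis P); split=> //; split=> //=.
  by rewrite heightD xk mul1r; apply/andP; split; lra.
have /closure_id -> := @boundary_closed (between P k l).
apply: closureS => x [Px xk].
rewrite (boundary_open (@between_open k l)); split; last first.
  by case=> _ /=; rewrite xk ltxx andbF.
move=> N xN.
have [|t [t0 tl [Nt Pt]]] := @axis_shift x (N `&` domain P) (-1) _ _ lkl.
  by apply: filterI => //; exact: open_nbhs_nbhs.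
exists (x + (-1 * t) *: axis P); split=> //; split=> //=.
by rewrite heightD xk mulN1r; apply/andP; split; lra.
Qed.

End slab_geometry.

(** * The equilibrium operator is Hilbert-Schmidt and compact *)

Section equilibrium.
Context (R : realType) (d : nat) (P : slabs R d).
Hypothesis d0 : (0 < d)%N.
Hypothesis P_slabs : slab_decomposition P.
Context (G : nat -> 'rV[R]_d -> 'rV[R]_d -> R).
Hypothesis G_regular : forall k, (0 < k <= nds P)%N ->
  continuous_off_diagonal (double_slab P k) (G k).
Local Notation V := 'rV[R]_d.
Local Notation T := (caratheodory_type (surface_outer R d)).
Local Notation N := (nds P).
Local Notation mu := (surface R d).
Local Notation X := (L2_sum P).
Local Notation dot := (L2_dot P).
Local Notation K := (equilibrium_K P G).

Let E (i : 'I_N) : set T := interface P i.+1.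

Let mE i : measurable (E i).
Proof. exact/closed_surface_measurable/interface_closed. Qed.

Let fE i : (mu (E i) < +oo)%E.
Proof. exact: interface_finite. Qed.

Lemma L2_sum_semi_inner : semi_inner X dot.
Proof. exact: (@L2_semi_inner _ T R mu N E mE). Qed.

(* For the first and the last double slab one of these two carries no unknown;
   it is kept, so that all double slabs are treated alike. *)
Let B (i : 'I_N) : set V := interface P i `|` interface P i.+2.

Lemma interfaces_off_diagonal (i : 'I_N) x y :
  E i x -> B i y -> [/\ closure (double_slab P i.+1) x,
    boundary (double_slab P i.+1) y & x <> y].
Proof.
move=> Ex By; split.
- by apply: (interface_sub_closure P_slabs (k := i) (m := i.+2)) Ex; rewrite !ltnS leqnn.
- have [h1 h2] := interface_sub_boundary P_slabs (k := i) (l := i.+2) (ltnW (ltnSn _)).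
  by case: By => [/h1|/h2].
- move=> xy; have := interface_height Ex; rewrite xy => lx.
  have [|] := By => /interface_height; rewrite lx => /eqP;
  by rewrite eq_le !leNgt !(level_lt P_slabs) ltnSn ?andbF.
Qed.

Lemma G_interfaces_continuous (i : 'I_N) :
  {within E i `*` B i, continuous (fun p => G i.+1 p.1 p.2)}.
Proof.
have iN : (0 < i.+1 <= N)%N by rewrite ltn_ord.
apply: continuous_subspaceW (G_regular iN) => -[x y] [/= Ex By].
exact: interfaces_off_diagonal.
Qed.

Let adj (i k : 'I_N) := (k.+1 == i :> nat) || (k == i.+1 :> nat).

Let adj_sub i k : adj i k -> E k `<=` B i.
Proof.
by rewrite /E /B => /orP[/eqP->|/eqP->] x Ex; [left|right].
Qed.

Definition kernel_family (i : 'I_N) (x : V) : 'I_N -> V -> R :=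
  fun k => if adj i k then G i.+1 x else fun=> 0.

Lemma equilibrium_KE u i x : K u i x = dot (kernel_family i x) u.
Proof.
rewrite /equilibrium_K fct_sumE big_mkcond; apply: eq_bigr => k _.
rewrite /kernel_family -/(adj i k); case: ifP => // _.
rewrite (@eq_Rintegral _ _ _ _ _ (fun=> 0)); last by move=> y _; rewrite mul0r.
by rewrite Rintegral_cst ?mul0r//; exact: (mE k).
Qed.

Let Ec i : compact (E i : set V). Proof. exact: interface_compact. Qed.
Let Bc i : compact (B i).
Proof. by apply: compactU; exact: interface_compact. Qed.

Lemma kernel_family_mem i x : E i x -> X (kernel_family i x).
Proof.
move=> Ex k; have [C HC] := kernel_bounded (@Ec i) (@Bc i) (@G_interfaces_continuous i).
have := @bounded_Lfun2 _ T R mu (E k) (mE k) (kernel_family i x k) (Num.max C 0) (fE k).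
apply; rewrite /kernel_family.
  case: ifP => [ik|_]; last exact: measurable_cst.
  apply: within_surface_measurable; first exact: interface_closed.
  apply: continuous_subspaceW (adj_sub ik) _.
  by have := kernel_section (@G_interfaces_continuous i) Ex; exact.
move=> y Ey; case: ifP => [ik|_]; last by rewrite normr0 le_max lexx orbT.
by rewrite le_max (HC x y Ex (adj_sub ik Ey)).
Qed.

Let mass := Num.sqrt (total_mass mu E) + 1.

Let mass_gt0 : 0 < mass. Proof. by rewrite ltr_wpDl// sqrtr_ge0. Qed.

Lemma kernel_family_dist i x x' (e : R) : 0 <= e -> E i x -> E i x' ->
  (forall y, B i y -> `|G i.+1 x y - G i.+1 x' y| <= e) ->
  nrm dot (kernel_family i x - kernel_family i x') <= e * mass.
Proof.
move=> e0 Ex Ex' xx'.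
have XB := memB L2_sum_semi_inner (kernel_family_mem Ex) (kernel_family_mem Ex').
apply: (@le_trans _ _ (e * Num.sqrt (total_mass mu E))); last first.
  by rewrite ler_wpM2l// lerDl.
rewrite -(@ler_pXn2r _ 2)// ?nnegrE ?mulr_ge0 ?sqrtr_ge0//.
rewrite exprMn [Num.sqrt (total_mass _ _) ^+ 2]sqr_sqrtr; last exact: total_mass_ge0.
apply: (@sup_le_nrm _ T R mu N E mE fE) => // k y Ey.
rewrite -[(_ - _) k y]/(kernel_family i x k y - kernel_family i x' k y).
rewrite /kernel_family; case: ifP => [ik|_]; last by rewrite subrr normr0.
exact/xx'/(adj_sub ik).
Qed.

Lemma equilibrium_K_continuous u i : X u ->
  {within (E i : set V), continuous (K u i)}.
Proof.
move=> Xu; apply/within_contP => x Ex e e0.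
pose c := mass * (nrm dot u + 1).
have c0 : 0 < c by rewrite mulr_gt0// ltr_wpDl// sqrtr_ge0.
have := kernel_equicontinuous (@Bc i) (@G_interfaces_continuous i) Ex (divr_gt0 e0 c0).
apply: filterS => x' H Ex'; rewrite !equilibrium_KE.
have S := L2_sum_semi_inner.
have [Xx Xx'] := (kernel_family_mem Ex, kernel_family_mem Ex').
have Xd := memB S Xx Xx'.
rewrite -(dotNl S)// -(dotDl S)//; last exact: (memN S).
apply: le_trans (cauchy_schwarz S Xd Xu) _.
have ec0 : 0 <= e / c by rewrite divr_ge0 ?ltW.
have h := kernel_family_dist ec0 Ex Ex' (H Ex').
apply: (@le_trans _ _ (e / c * mass * (nrm dot u + 1))).
  by rewrite ler_pM ?sqrtr_ge0// lerDl.
by rewrite -mulrA divfK// gt_eqF.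
Qed.

Let kernel_family_bound : exists C, forall i x, E i x -> nrm dot (kernel_family i x) <= C.
Proof.
have /choice[C HC] i : exists C, forall x, E i x -> nrm dot (kernel_family i x) <= C.
  have [C HC] := kernel_bounded (@Ec i) (@Bc i) (@G_interfaces_continuous i).
  exists (Num.sqrt (`|C| ^+ 2 * total_mass mu E)) => x Ex.
  rewrite -(@ler_pXn2r _ 2)// ?nnegrE ?sqrtr_ge0//.
  have tm := total_mass_ge0 mu E.
  rewrite [Num.sqrt (_ * _) ^+ 2]sqr_sqrtr ?mulr_ge0 ?sqr_ge0//.
  apply: (@sup_le_nrm _ T R mu N E mE fE) => //; first exact: kernel_family_mem.
  move=> k y Ey; rewrite /kernel_family; case: ifP => [ik|_]; last by rewrite normr0.
  by apply: le_trans (HC x y Ex (adj_sub ik Ey)) _; exact: ler_norm.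
exists (\sum_i `|C i|) => i x Ex; apply: le_trans (HC i x Ex) _.
by rewrite (bigD1 i)//= ler_wpDr ?ler_norm// sumr_ge0.
Qed.

Let kernel_family_net i (e : R) : 0 < e -> exists s : seq T,
  {in s, forall y, E i y} /\ forall x, E i x ->
    exists2 y, y \in s & nrm dot (kernel_family i x - kernel_family i y) <= e.
Proof.
move=> e0.
have [s [sE sn]] := kernel_net (@Ec i) (@Bc i) (@G_interfaces_continuous i)
  (divr_gt0 e0 mass_gt0).
exists s; split=> // x Ex; have [y ys xy] := sn x Ex; exists y => //.
rewrite -[leRHS](divfK (lt0r_neq0 mass_gt0)).
apply: kernel_family_dist => //; [by rewrite divr_ge0 ?ltW|exact: sE|].
by move=> z Bz; rewrite distrC; exact: xy.
Qed.

Let K_measurable u : X u -> forall i, measurable_fun (E i) (K u i : T -> R).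
Proof.
move=> Xu i; apply: within_surface_measurable; first exact: interface_closed.
exact: equilibrium_K_continuous.
Qed.

Theorem equilibrium_hilbert_schmidt : hilbert_schmidt X dot K.
Proof.
have [C HC] := kernel_family_bound.
apply: (@kernel_operator_hilbert_schmidt _ T R mu N E mE fE kernel_family C K) => //.
- exact: kernel_family_mem.
- by move=> u _ i x _; exact: equilibrium_KE.
Qed.

Theorem equilibrium_compact : compact_operator X dot K.
Proof.
have [C HC] := kernel_family_bound.
apply: (@kernel_operator_compact _ T R mu N E mE fE kernel_family C K) => //.
- exact: kernel_family_mem.
- by move=> u _ i x _; exact: equilibrium_KE.
Qed.

End equilibrium.

(** * The Poisson kernel at the boundary *)

Section poisson.
Context (R : realType) (d : nat) (A : diffop R d) (D : set 'rV[R]_d).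
Context (G : 'rV[R]_d -> 'rV[R]_d -> R).
Local Notation V := 'rV[R]_d.
Local Notation T := (caratheodory_type (surface_outer R d)).
Local Notation mu := (surface R d).
Local Notation Bd := (boundary D).
Hypothesis solvable : local_uniquely_solvable A D.
Hypothesis G_poisson : poisson_kernel A D G.
Hypothesis G_regular : continuous_off_diagonal D G.

Let mBd : measurable (Bd : set T).
Proof. exact/closed_surface_measurable/boundary_closed. Qed.

Lemma bump_continuous (y0 : V) (r : R) :
  continuous (fun y : V => Num.max 0 (r - `|y - y0|)).
Proof.
have cB : continuous (fun y : V => r - `|y - y0|).
  by move=> y; exact: (cvgB (cvg_cst r) (cvg_norm (cvgB cvg_id (cvg_cst y0)))).
exact: (max_fun_continuous (@cst_continuous V R 0) cB).
Qed.

(** Test the kernel against a continuous bump supported in the ball of radius [r]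
    around [y0]. Up to the sign [s], the solution [v] with this boundary value is
    at least [c] times the integral of the bump at the points of [D] near [x0];
    but [v] tends there to the value of the bump at [x0], which is 0. So the
    bump has integral 0, and the boundary is null in the smaller ball where the
    bump is large. *)
Lemma poisson_kernel_bump (x0 y0 : V) (s c r : R) (N : set V) :
  Bd x0 -> 0 < c -> 0 < r -> nbhs x0 N -> r <= `|x0 - y0| ->
  (forall x y, N x -> D x -> Bd y -> `|y - y0| < r -> c <= s * G x y) ->
  exists2 U, nbhs y0 U & mu (Bd `&` U) = 0%E.
Proof.
move=> Bx0 c0 r0 Nx0 rxy cG.
pose phi (y : V) := Num.max 0 (r - `|y - y0|).
have phi_cont : continuous phi by exact: bump_continuous.
have phi0 y : 0 <= phi y by rewrite le_max lexx.
have [v sol _] := solvable (continuous_subspaceT phi_cont).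
have [_ v_cont _ v_bd] := sol.
have vx0 : v x0 = 0.
  by rewrite v_bd// /phi; apply/max_idPl; rewrite subr_le0.
have mphi : measurable_fun (Bd : set T) (phi : T -> R).
  apply: within_surface_measurable; first exact: boundary_closed.
  exact: continuous_subspaceT.
pose h (y : V) := (c * phi y)%:E.
have mh : measurable_fun (Bd : set T) (h : T -> \bar R).
  by apply/measurable_EFinP; apply: measurable_funM => //; exact: measurable_cst.
have int_le x : N x -> D x -> (\int[mu]_(y in Bd) h y <= (s * v x)%:E)%E.
  move=> Nx Dx.
  have [Gint ->] := G_poisson (continuous_subspaceT phi_cont) sol Dx.
  rewrite -RintegralZl//.
  have sGint := integrableZl mBd s Gint.
  rewrite /Rintegral fineK; last exact: (integrable_fin_num mBd sGint).
  apply: ge0_le_integral;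
    [exact: mBd| |exact: mh|exact: (measurable_int _ sGint)|].
    by move=> y _; rewrite lee_fin mulr_ge0// ltW.
  move=> y By; rewrite lee_fin mulrA.
  have [yr|yr] := ltP `|y - y0| r; first by rewrite ler_wpM2r// cG.
  have -> : phi y = 0 by apply/max_idPl; rewrite subr_le0.
  by rewrite !mulr0.
have int0 : (\int[mu]_(y in Bd) h y <= 0)%E.
  apply/lee_addgt0Pr => e e0; rewrite add0e.
  have e' : 0 < e / (`|s| + 1) by rewrite divr_gt0// ltr_wpDl.
  have Bc : closure D x0 by case: Bx0.
  have vnear := (within_contP _ _).1 v_cont x0 Bc _ e'.
  have [x [Dx [Nx vx]]] := Bc _ (filterI Nx0 vnear).
  apply: le_trans (int_le x Nx Dx) _; rewrite lee_fin.
  have := vx (subset_closure Dx); rewrite vx0 sub0r normrN => vxe.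
  apply: le_trans (ler_norm _) _; rewrite normrM.
  apply: (@le_trans _ _ (`|s| * (e / (`|s| + 1)))); first by rewrite ler_wpM2l.
  rewrite mulrCA ger_pMr// ler_pdivrMr ?ltr_wpDl// mul1r.
  by rewrite lerDl.
(* on the ball of radius r / 2 the bump is at least r / 2 *)
pose a := c * (r / 2); have a0 : 0 < a by rewrite mulr_gt0// divr_gt0.
exists [set y | (a%:E <= `|h y|)%E].
  have := nbhsx_ballx y0 (r / 2) (divr_gt0 r0 (ltr0n _ 2)).
  apply: filterS => y; rewrite -ball_normE => yr.
  change (a%:E <= `|h y|)%E; have {}yr : `|y0 - y| < r / 2 := yr.
  rewrite gee0_abs; last by rewrite lee_fin mulr_ge0// ltW.
  rewrite lee_fin /a ler_pM2l//.
  by rewrite /phi le_max; apply/orP; right; rewrite distrC; lra.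
have := le_integral_abse mu mBd mh a0.
under eq_integral do rewrite gee0_abs ?lee_fin ?mulr_ge0 ?(ltW c0)//.
move=> /le_trans/(_ int0) le0.
apply/eqP; rewrite eq_le measure_ge0 andbT.
by move: le0; rewrite pmule_rle0// lte_fin.
Qed.

(** By continuity off the diagonal, the kernel keeps its sign and at least half of
    its size near [(x0, y0)]; the two neighbourhoods are shrunk to be disjoint. *)
Lemma poisson_kernel_vanish (x0 y0 : V) : Bd x0 -> Bd y0 -> x0 <> y0 ->
  G x0 y0 != 0 -> exists2 U, nbhs y0 U & mu (Bd `&` U) = 0%E.
Proof.
move=> Bx0 By0 xy0 G0.
have c0 : 0 < `|G x0 y0| / 2 by rewrite divr_gt0// normr_gt0.
have S0 : [set p : V * V | [/\ closure D p.1, boundary D p.2 & p.1 <> p.2]] (x0, y0).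
  by split=> //; case: Bx0.
have := (within_contP _ _).1 G_regular (x0, y0) S0 _ c0.
case=> -[P Q] /= [xP /nbhs_ballP[q /= q0 yQ]] PQ.
have t0 : 0 < `|x0 - y0| by rewrite normr_gt0 subr_eq0; exact/eqP.
pose r := Num.min q (`|x0 - y0| / 2).
have r0 : 0 < r by rewrite lt_min q0 divr_gt0.
pose N := P `&` ball x0 (`|x0 - y0| / 2).
apply: (@poisson_kernel_bump x0 y0 (Num.sg (G x0 y0)) (`|G x0 y0| / 2) r N) => //.
- by apply: filterI => //; apply: nbhsx_ballx; rewrite divr_gt0.
- by rewrite /r ge_min; apply/orP; right; lra.
move=> x y [Px]; rewrite -ball_normE /= => xx0 Dx By; rewrite lt_min => /andP[yq yr].
have xy : x <> y.
  move=> xy; have := ler_distD x x0 y0; rewrite {2}xy; lra.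
have Qy : Q y by apply: yQ; rewrite -ball_normE/= distrC.
have := PQ (x, y) (conj Px Qy) (And3 (subset_closure Dx) By xy) => /= GG.
case: (ltgtP (G x0 y0) 0) G0 GG => // G0 _.
  rewrite (ltr0_sg G0) mulN1r (ltr0_norm G0) ler_norml => /andP[? ?]; lra.
by rewrite (gtr0_sg G0) mul1r (gtr0_norm G0) ler_norml => /andP[? ?]; lra.
Qed.

(** Each set of [y] in [C] with [1/(n+1) <= `|G x0 y|] is compact and is covered by
    open sets that meet the boundary in null sets. *)
Lemma poisson_kernel_null (x0 : V) (C : set V) : Bd x0 -> compact C ->
  C `<=` Bd -> ~ C x0 -> mu (C `&` [set y | G x0 y != 0]) = 0%E.
Proof.
move=> Bx0 Cc CB Cx0.
have Ccl : closed C by apply: compact_closed => //; exact: norm_hausdorff.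
have GC : {within C, continuous (G x0)}.
  apply/within_contP => y Cy e e0.
  have S0 : [set p : V * V | [/\ closure D p.1, boundary D p.2 & p.1 <> p.2]] (x0, y).
    by split=> /=; [case: Bx0|exact: CB|move=> xy; apply: Cx0; rewrite xy].
  have := (within_contP _ _).1 G_regular (x0, y) S0 _ e0.
  case=> -[P Q] /= [xP yQ] PQ; apply: filterS yQ => z Qz Cz.
  apply: (PQ (x0, z)); first by split=> //; exact: nbhs_singleton.
  by split=> /=; [case: Bx0|exact: CB|move=> xz; apply: Cx0; rewrite xz].
pose level n := C `&` G x0 @^-1` [set t | n.+1%:R^-1 <= `|t|].
have level_compact n : compact (level n).
  apply: (subclosed_compact _ Cc); last by move=> x [].
  apply: within_closed_preimage => //.
  have cl : closed ((fun t : R => `|t|) @^-1` [set t | n.+1%:R^-1 <= t]).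
    by apply: closed_comp; [move=> t _; exact: norm_continuous|exact: closed_ge].
  exact: cl.
have null_level n : mu (level n) = 0%E.
  have /choice[U UP] y : exists U : set V, level n y ->
      [/\ open U, U y & mu (Bd `&` U) = 0%E].
    have [ly|] := pselect (level n y); last by exists set0.
    have [Cy Gy] := ly.
    have [||U Uy U0] := @poisson_kernel_vanish x0 y Bx0 (CB _ Cy).
    - by move=> xy; apply: Cx0; rewrite xy.
    - by rewrite -normr_gt0; apply: lt_le_trans Gy; rewrite invr_gt0.
    exists U° => _; split; [exact: open_interior|by []|].
    apply/eqP; rewrite eq_le measure_ge0 andbT -U0.
    by apply: (@le_hausdorff R d) => z [? /interior_subset].
  have := level_compact n; rewrite compact_cover => /(_ _ (level n) U).
  case=> [y /UP[]//|y ly|F Fl Fcov].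
    by exists y => //; case: (UP y ly).
  have null_seq (s : seq V) : {in s, forall y, level n y} ->
      mu (Bd `&` [set z | exists2 y, y \in s & U y z]) = 0%E.
    elim: s => [_|y s IH sl].
      rewrite (_ : _ `&` _ = set0) ?measure0//.
      by apply/seteqP; split=> // z [_ [y]].
    apply/eqP; rewrite eq_le measure_ge0 andbT.
    have yl := sl y (mem_head _ _); have [_ _ U0] := UP y yl.
    have /IH {}IH : {in s, forall y, level n y}.
      by move=> z zs; apply: sl; rewrite in_cons zs orbT.
    rewrite -[leRHS]adde0 -{1}U0 -IH.
    apply: le_trans (outer_measureU2 (surface_outer R d) _ _).
    apply: (@le_hausdorff R d) => z [Bz [y']]; rewrite in_cons => /predU1P[->|y's] Uz.
      by left.
    by right; split=> //; exists y'.
  apply/eqP; rewrite eq_le measure_ge0 andbT -(null_seq (finmap.enum_fset F)).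
    apply: (@le_hausdorff R d) => z lz; split; first by case: lz => /CB.
    by have [y Fy Uz] := Fcov z lz; exists y.
  by move=> y yF; have := Fl y yF; rewrite inE.
apply/eqP; rewrite eq_le measure_ge0 andbT.
have sub : C `&` [set y | G x0 y != 0] `<=` \bigcup_n level n.
  move=> y [Cy /=]; rewrite -normr_gt0 => Gy.
  have [n Hn] := cvg0_lt (@cvg_harmonic R) Gy.
  exists n => //; split=> //=; apply: le_trans (ler_norm _) _.
  exact/ltW/Hn.
apply: le_trans (@le_hausdorff R d d.-1 _ _ sub) _.
apply: le_trans (hausdorff_sigma_subadditive _ _) _.
by rewrite eseries0// => n _ _; exact: null_level.
Qed.

End poisson.

(** * Locality of classical solutions *)

Section local.
Context (R : realType) (d : nat) (A : diffop R d).
Local Notation V := 'rV[R]_d.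
Implicit Types (D : set V) (f g v w : V -> R).

Lemma continuous_at_near v w (x : V) : (\forall y \near x, v y = w y) ->
  {for x, continuous w} -> {for x, continuous v}.
Proof.
move=> vw cw N /= vxN; rewrite (nbhs_singleton vw) in vxN.
by apply: filterS (filterI vw (cw _ vxN)) => y /= [->].
Qed.

Lemma near_open D v w (x : V) : open D -> (forall y, D y -> v y = w y) ->
  D x -> \forall y \near x, v y = w y.
Proof. by move=> Do vw Dx; apply: filterS (open_nbhs_nbhs (conj Do Dx)). Qed.

Lemma partial_eq_on D i v w : open D -> (forall y, D y -> v y = w y) ->
  forall x, D x -> partial i v x = partial i w x.
Proof. by move=> Do vw x Dx; apply: near_eq_derive; exact: near_open Dx. Qed.

(** Partial derivatives at a point only see a neighbourhood of it. *)
Lemma C2_on_eq D v w : open D -> (forall y, D y -> v y = w y) ->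
  C2_on D w -> C2_on D v.
Proof.
move=> Do vw [c0 c1 c2].
have wv y : D y -> w y = v y by move=> Dy; rewrite vw.
have pvw i := partial_eq_on i Do vw.
have pwv i := partial_eq_on i Do wv.
split=> [x Dx|i x Dx|i j x Dx].
- by apply: continuous_at_near (c0 x Dx); exact: near_open Dx.
- have [dw cw] := c1 i x Dx; split.
    by apply: near_eq_derivable dw; exact: near_open Dx.
  by apply: continuous_at_near cw; exact: near_open (pvw i) Dx.
- have [dw cw] := c2 i j x Dx; split.
    by apply: near_eq_derivable dw; exact: near_open (pwv i) Dx.
  by apply: continuous_at_near cw; exact: near_open (partial_eq_on j Do (pvw i)) Dx.
Qed.

Lemma diffop_app_eq D v w : open D -> (forall y, D y -> v y = w y) ->
  forall x, D x -> diffop_app A v x = diffop_app A w x.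
Proof.
move=> Do vw x Dx.
have pvw i := partial_eq_on i Do vw.
have ppvw i j := partial_eq_on j Do (pvw i) Dx.
rewrite /diffop_app (vw x Dx); apply: (congr2 +%R) => //; apply: (congr2 +%R).
  by apply: eq_bigr => i _; apply: eq_bigr => j _; rewrite ppvw.
by apply: eq_bigr => i _; rewrite pvw.
Qed.

Lemma dirichlet_solution_sub D D' f g v : D' `<=` D ->
  dirichlet_solution A D f g v -> dirichlet_solution A D' f v v.
Proof.
move=> DD [[c0 c1 c2] cv eq_ _]; split=> //.
- by split=> [x /DD/c0|i x /DD/c1|i j x /DD/c2].
- exact: continuous_subspaceW (closureS DD) cv.
- by move=> x /DD/eq_.
Qed.

Lemma dirichlet_solution_boundary D f g g' v :
  (forall x, boundary D x -> g x = g' x) ->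
  dirichlet_solution A D f g v -> dirichlet_solution A D f g' v.
Proof.
by move=> gg [? ? ? vg]; split=> // x Bx; rewrite vg// gg.
Qed.

Lemma dirichlet_solution0 D : dirichlet_solution A D (fun=> 0) (fun=> 0) (fun=> 0).
Proof.
have p0 i : partial i (fun=> 0 : R) = (fun=> 0) :> (V -> R).
  by apply/funext => x; exact: derive_cst.
split=> //.
- split=> [x _|i x _|i j x _].
  + exact: cst_continuous.
  + by rewrite p0; split; [exact: derivable_cst|exact: cst_continuous].
  + by rewrite !p0; split; [exact: derivable_cst|exact: cst_continuous].
- exact/continuous_subspaceT/cst_continuous.
move=> x _; rewrite /diffop_app mulr0 addr0.
rewrite [X in X + _]big1 ?add0r => [|i _].
  by apply: big1 => i _; rewrite p0 mulr0.
by apply: big1 => j _; rewrite !p0 mulr0.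
Qed.

End local.

(** * Gluing the local solutions *)

Section gluing.
Context (R : realType) (d : nat) (P : slabs R d) (A : diffop R d).
Hypothesis d0 : (0 < d)%N.
Hypothesis P_slabs : slab_decomposition P.
Context (G : nat -> 'rV[R]_d -> 'rV[R]_d -> R).
Local Notation V := 'rV[R]_d.
Local Notation T := (caratheodory_type (surface_outer R d)).
Local Notation N := (nds P).
Local Notation mu := (surface R d).
Local Notation Om := (domain P).
Local Notation height := (dotv (axis P)).
Hypothesis single_solvable : forall k, (k <= N)%N ->
  local_uniquely_solvable A (single_slab P k).
Hypothesis double_solvable : forall k, (0 < k <= N)%N ->
  local_uniquely_solvable A (double_slab P k).
Hypothesis G_poisson : forall k, (0 < k <= N)%N ->
  poisson_kernel A (double_slab P k) (G k).
Hypothesis G_regular : forall k, (0 < k <= N)%N ->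
  continuous_off_diagonal (double_slab P k) (G k).

Context (w : 'I_N -> V -> R).
Hypothesis w_mem : L2_sum P w.
Hypothesis w_fix : forall (i : 'I_N) x, interface P i.+1 x -> w i x = equilibrium_K P G w i x.

Let E (i : 'I_N) : set T := interface P i.+1.
Let psi (i : 'I_N) : set V := double_slab P i.+1.
Let adj (i k : 'I_N) := (k.+1 == i :> nat) || (k == i.+1 :> nat).

Let iN (i : 'I_N) : (0 < i.+1 <= N)%N. Proof. exact: ltn_ord. Qed.

Let psi_open i : open (psi i). Proof. exact: between_open. Qed.

Let Om_open : open Om. Proof. by have [[]] := P_slabs. Qed.

Let mE i : measurable (E i).
Proof. exact/closed_surface_measurable/interface_closed. Qed.

Let E_inj i k x : E i x -> E k x -> i = k.
Proof.
move=> /interface_height h1 /interface_height; rewrite h1 => /eqP h.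
apply: val_inj => /=; move: h; rewrite eq_le !leNgt !(level_lt P_slabs) !ltnS.
by rewrite -!leqNgt -eqn_leq => /eqP.
Qed.

Let adj_neq i k : adj i k -> i <> k.
Proof.
move=> + ik; rewrite ik /adj => /orP[|];
by rewrite ?(gtn_eqF (ltnSn _)) ?(ltn_eqF (ltnSn _)).
Qed.

Let adj_boundary i k : adj i k -> E k `<=` boundary (psi i).
Proof.
move=> ik x Ex.
have [h1 h2] := interface_sub_boundary P_slabs (k := i) (l := i.+2) (ltnW (ltnSn _)).
case/orP: ik => /eqP ki; first by apply: h1; rewrite -ki.
by apply: h2; rewrite -ki.
Qed.

Let E_closure i : E i `<=` closure (psi i).
Proof.
move=> x; apply: (interface_sub_closure P_slabs (k := i) (m := i.+2)).
by rewrite !ltnS leqnn.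
Qed.

Let psi_boundary i x : closure (psi i) x -> ~ Om x -> boundary (psi i) x.
Proof. by move=> cx Ox; rewrite boundary_open//; split=> // -[]. Qed.

Let closure_height k l x : closure (between P k l) x -> level P k <= height x <= level P l.
Proof.
suff : closure (between P k l) `<=` height @^-1` [set t | level P k <= t <= level P l].
  by apply.
have cl : closed (height @^-1` [set t | level P k <= t <= level P l]).
  apply: closed_comp; first by move=> y _; exact: dotv_continuous.
  exact: (@interval_closed R (BLeft (level P k)) (BRight (level P l))).
rewrite [X in _ `<=` X]((closure_id _).1 cl).
by apply: closureS => y [_ /andP[/ltW h1 /ltW h2]] /=; rewrite h1 h2.
Qed.

(** At a point of the physical boundary the Poisson kernel of the double slab
    vanishes almost everywhere on the neighbouring interfaces, so the right-hand
    side of the equilibrium equation is 0. *)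
Lemma fixpoint_vanishes i x : E i x -> ~ Om x -> w i x = 0.
Proof.
move=> Ex Ox; rewrite w_fix// equilibrium_KE; apply: big1 => k _.
have Bx := psi_boundary (E_closure Ex) Ox.
rewrite /kernel_family -/(adj i k); case: ifPn => ik; last first.
  rewrite (@eq_Rintegral _ _ _ _ _ (fun=> 0)) ?Rintegral_cst ?mul0r//; last first.
    by move=> y _; rewrite mul0r.
  exact: (mE k).
have Ekx : ~ E k x by move=> /(E_inj Ex); exact: adj_neq.
have Kx := kernel_family_mem d0 P_slabs G_regular Ex.
have Gm : measurable_fun (E k) (G i.+1 x : T -> R).
  have := Lfun2_measurable (mE k) (Kx k).
  by rewrite /kernel_family -/(adj i k) ik.
have wm : measurable_fun (E k) (w k : T -> R) := Lfun2_measurable (mE k) (w_mem k).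
have null := poisson_kernel_null (double_solvable (iN i)) (G_poisson (iN i))
  (G_regular (iN i)) Bx (@interface_compact R d P P_slabs k.+1) (@adj_boundary i k ik) Ekx.
pose f (y : T) : \bar R := (G i.+1 x y * w k y)%:E.
have fm : measurable_fun (E k) f.
  by apply/measurable_EFinP; exact: measurable_funM.
have f0 : ae_eq mu (E k) f (cst 0%E).
  exists (E k `&` [set y | G i.+1 x y != 0]); split=> //.
    have -> : [set y | G i.+1 x y != 0] = (G i.+1 x : T -> R) @^-1` (~` [set 0]).
      by apply/seteqP; split=> y /=; [move=> /eqP|move=> /eqP].
    by apply: Gm => //; apply: measurableC; exact: measurable_set1.
  move=> y /= /not_implyP[Ey ne]; split=> //.
  by apply/eqP => G0; apply: ne; rewrite /f G0 mul0r.
have intf : (\int[mu]_(y in E k) f y = \int[mu]_(y in E k) cst 0 y)%E.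
  exact: (@ae_eq_integral _ _ _ mu (E k) (cst 0%E) f (mE k) fm (measurable_cst _) f0).
by rewrite /Rintegral -[X in fine X]/(\int[mu]_(y in E k) f y)%E intf integral0.
Qed.

(* Dirichlet data on the double slab: the values of [w] on the neighbouring
   interfaces and 0 on the rest of the boundary. *)
Let phi i (y : V) : R := \sum_(k < N | adj i k) (w k \_ (E k)) y.

Let phi_E i k y : adj i k -> E k y -> phi i y = w k y.
Proof.
move=> ik Ey; rewrite /phi (bigD1 k)//= big1 ?addr0 => [|l /andP[il lk]].
  by rewrite patchE mem_set.
rewrite patchE memNset// => El; move/eqP: lk; apply.
exact: E_inj El Ey.
Qed.

Let phi_off i y : ~ Om y -> phi i y = 0.
Proof.
move=> Oy; apply: big1 => k ik; rewrite patchE; case: ifPn => //.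
by rewrite inE => Ey; exact: fixpoint_vanishes.
Qed.

Let w_continuous i : {within (E i : set V), continuous (w i)}.
Proof.
apply/within_contP => x Ex e e0.
have Kw := equilibrium_K_continuous d0 P_slabs G_regular (i := i) w_mem.
have := (within_contP _ _).1 Kw x Ex e e0.
by apply: filterS => y H Ey; rewrite !w_fix//; exact: H.
Qed.

(* The pieces fit together: around a point of the domain the boundary of the
   double slab consists of the interface alone, and where the interface meets the
   physical boundary [w] vanishes. *)
Let phi_continuous i : {within boundary (psi i), continuous (phi i)}.
Proof.
apply: continuous_big => [|k ik]; first exact: add_continuous.
apply/within_contP => y By e e0.
have [Ey|Ey] := pselect (E k y); last first.
  have : \forall z \near y, (~` (E k : set V)) z.
    by apply: open_nbhs_nbhs; split=> //; exact/closed_openC/interface_closed.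
  apply: filterS => z Ez _.
  by rewrite !patchE !memNset// subrr normr0 ltW.
have wy := (within_contP _ _).1 (@w_continuous k) y Ey e e0.
have [Oy|Oy] := pselect (Om y); last first.
  apply: filterS wy => z H Bz; rewrite !patchE mem_set//.
  case: ifPn; rewrite ?inE => Ez; first exact: H.
  by rewrite fixpoint_vanishes// subrr normr0 ltW.
have Oz : \forall z \near y, Om z by exact: open_nbhs_nbhs.
have h : 0 < width P by have [] := P_slabs.
have Hz : \forall z \near y, `|height y - height z| < width P.
  have hc := @dotv_continuous R d (axis P) y.
  have hn : nbhs y (height @^-1` ball (height y) (width P)).
    by apply: hc; exact: nbhsx_ballx.
  by apply: filterS hn => z; rewrite /= -ball_normE.
apply: filterS (filterI wy (filterI Oz Hz)) => z [H [Oz' Hz']] Bz.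
(* z is in the closure of the double slab but not inside, hence at one of the
   two bounding levels, and its height is less than one width away from that of y *)
suff Ez : E k z by rewrite !patchE !mem_set//; exact: H.
move: Bz; rewrite boundary_open// => -[/closure_height/andP[l1 l2] nz].
have hy : height y = level P k.+1 by exact: interface_height Ey.
apply: subset_closure; split=> //=.
have : ~ (level P i < height z < level P i.+2) by move=> hz; apply: nz.
have lS m : level P m.+1 = level P m + width P.
  by rewrite /level -natr1 mulrDl mul1r addrA.
have li2 : level P i.+2 = level P i + 2 * width P.
  by rewrite !lS -addrA -mulr2n mulr_natl.
move/negP; rewrite negb_and -!leNgt li2.
move: Hz' l1 l2; rewrite li2 ltr_norml => /andP[hz1 hz2] l1 l2 nlt.
apply/eqP; rewrite eq_le; case/orP: ik => /eqP ki.
  rewrite ki in hy *.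
  by case/orP: nlt => ?; apply/andP; split; lra.
rewrite ki li2 in hy *.
by case/orP: nlt => ?; apply/andP; split; lra.
Qed.

Let local_solution : exists v : 'I_N -> V -> R,
  forall i, dirichlet_solution A (psi i) (fun=> 0) (phi i) (v i).
Proof.
have /choice[v vP] i : exists v, dirichlet_solution A (psi i) (fun=> 0) (phi i) v.
  by have [v vP _] := double_solvable (iN i) (@phi_continuous i); exists v.
by exists v.
Qed.

Section extension.
Context (v : 'I_N -> V -> R).
Hypothesis vP : forall i, dirichlet_solution A (psi i) (fun=> 0) (phi i) (v i).

Let v_boundary i y : boundary (psi i) y -> v i y = phi i y.
Proof. by have [_ _ _] := vP i; exact. Qed.

Let v_adj i k y : adj i k -> E k y -> v i y = w k y.
Proof.
by move=> ik Ey; rewrite -(phi_E ik Ey); apply/v_boundary/(adj_boundary ik).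
Qed.

(* The Poisson formula for [v i] is the right-hand side of the equilibrium
   equation at [x]. *)
Let v_central i x : E i x -> v i x = w i x.
Proof.
move=> Ex; have [Ox|Ox] := pselect (Om x); last first.
  by rewrite fixpoint_vanishes// v_boundary ?phi_off//; exact/psi_boundary/Ox/E_closure.
have psix : psi i x.
  split=> //=; rewrite (interface_height Ex) !(level_lt P_slabs).
  by rewrite !ltnSn.
have [Gint ->] := G_poisson (iN i) (@phi_continuous i) (vP i) psix.
rewrite w_fix// equilibrium_KE.
have mB : measurable (boundary (psi i) : set T).
  exact/closed_surface_measurable/boundary_closed.
have Kx := kernel_family_mem d0 P_slabs G_regular Ex.
pose F k := (fun y => kernel_family G i x k y * w k y) \_ (E k).
have intE k : mu.-integrable (E k) (EFin \o (fun y => kernel_family G i x k y * w k y)).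
  exact: (Lfun2_integrableM (mE k) (Kx k) (w_mem k)).
have intF : {in index_enum 'I_N, forall k, mu.-integrable (boundary (psi i)) (EFin \o F k)}.
  move=> k _; rewrite -restrict_EFin; apply/(integrable_restrict _ _ mB) => //.
  by apply: integrableS (intE k) => //; exact: measurableI.
rewrite (@eq_Rintegral _ _ _ _ _ (fun y => \sum_k F k y)); last first.
  move=> y _; rewrite /phi big_mkcond mulr_sumr; apply: eq_bigr => k _.
  rewrite /F /kernel_family -/(adj i k) !patchE.
  by case: (adj i k); case: ifP; rewrite ?mulr0 ?mul0r.
have [_ ->] := Rintegral_sum mB intF.
apply: eq_bigr => k _; rewrite /F -Rintegral_mkcondr.
have [ik|ik] := boolP (adj i k).
  by rewrite setIidr//; exact: adj_boundary.
have z S : measurable S ->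
    \int[mu]_(y in S) (kernel_family G i x k y * w k y) = 0.
  move=> mS; rewrite (@eq_Rintegral _ _ _ _ _ (fun=> 0)) ?Rintegral_cst ?mul0r//.
  by move=> y _; rewrite /kernel_family -/(adj i k) (negbTE ik) mul0r.
by rewrite (z _ (measurableI _ _ mB (mE k))) (z _ (mE k)).
Qed.

Let v_physical i y : closure (psi i) y -> ~ Om y -> v i y = 0.
Proof. by move=> cy Oy; rewrite v_boundary ?phi_off//; exact: psi_boundary. Qed.

(* In the single slab shared by two consecutive double slabs both local solutions
   have the same boundary values: on each bounding interface one of them takes
   the value of [w] as its datum and the other one as its central value. *)
Let v_agree (i j : 'I_N) x : j = i.+1 :> nat -> single_slab P i.+1 x -> v i x = v j x.
Proof.
move=> ji Sx.
have Si : single_slab P i.+1 `<=` psi i.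
  move=> y [Oy /andP[h1 h2]]; split=> //=.
  by rewrite h2 andbT (lt_trans _ h1)// (level_lt P_slabs).
have Sj : single_slab P i.+1 `<=` psi j.
  move=> y [Oy /andP[h1 h2]]; split=> //=; rewrite ji h1/= (lt_trans h2)//.
  by rewrite (level_lt P_slabs).
have aji : adj j i by rewrite /adj ji eqxx.
have aij : adj i j by rewrite /adj ji eqxx orbT.
have soli := dirichlet_solution_sub Si (vP i).
have vij y : boundary (single_slab P i.+1) y -> v j y = v i y.
  rewrite boundary_open; last exact: between_open.
  move=> [cy ny].
  have [Oy|Oy] := pselect (Om y); last first.
    by rewrite !v_physical//; [exact: closureS cy|exact: closureS cy].
  have /andP[h1 h2] := closure_height cy.
  have [lt1|ge1] := ltP (level P i.+1) (height y); last first.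
    have Ey : E i y.
      by apply: subset_closure; split=> //=; apply/eqP; rewrite eq_le ge1 h1.
    by rewrite (v_central Ey) (v_adj aji Ey).
  have [lt2|ge2] := ltP (height y) (level P i.+2).
    by case: ny; split=> //=; rewrite lt1.
  have Ey : E j y.
    by apply: subset_closure; split=> //=; apply/eqP; rewrite ji eq_le ge2 h2.
  by rewrite (v_central Ey) (v_adj aij Ey).
have solj := dirichlet_solution_boundary vij (dirichlet_solution_sub Sj (vP j)).
have [_ cv _ _] := soli.
have iNle : (i.+1 <= N)%N by exact: ltn_ord.
have [z _ zu] := single_solvable iNle (continuous_subspaceW (@subIsetl _ _ _) cv).
have cx := subset_closure Sx.
by rewrite (zu _ soli x cx) (zu _ solj x cx).
Qed.

Let v_consistent i j x : psi i x -> psi j x -> v i x = v j x.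
Proof.
wlog ij : i j / (i <= j)%N => [H|].
  by have /orP[ij|ji] := leq_total i j => ? ?; [|symmetry]; apply: H.
move=> [Ox /andP[_ h2]] [_ /andP[h3 _]].
move: ij; rewrite leq_eqVlt => /predU1P[/val_inj->//|ij].
have : (j < i.+2)%N by rewrite -(level_lt P_slabs); exact: lt_trans h3 h2.
rewrite ltnS => ji; have {}ji : j = i.+1 :> nat by apply/eqP; rewrite eqn_leq ji.
by apply: v_agree => //; split=> //=; rewrite h2 -ji h3.
Qed.

Let psi_cover x : (0 < N)%N -> Om x -> exists i, psi i x.
Proof.
move=> N0 Ox; have [_ _ h0 hO] := P_slabs.
have : [set height x | x in Om] (height x) by exists x.
rewrite hO /= => /andP[lx xl].
have [m lm mmin] := ex_minnP (ex_intro (fun m => height x < level P m.+1) N xl).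
have mN : (m <= N)%N by exact: mmin.
case: m lm mmin mN => [|m] lm mmin mN.
  exists (Ordinal N0); split=> //=; rewrite lx (lt_trans lm)// (level_lt P_slabs)//.
exists (Ordinal mN); split=> //=; rewrite lm andbT.
apply: (@lt_le_trans _ _ (level P m.+1)); first by rewrite (level_lt P_slabs).
by rewrite leNgt; apply/negP => /mmin; rewrite ltnn.
Qed.

Let glued x : R :=
  if pselect (exists i, psi i x) is left p then v (projT1 (cid p)) x else 0.

Let gluedE i x : psi i x -> glued x = v i x.
Proof.
move=> px; rewrite /glued; case: pselect => [p|[]]; last by exists i.
by case: cid => j pj /=; exact: v_consistent.
Qed.

Let glued_out x : ~ Om x -> glued x = 0.
Proof. by move=> Ox; rewrite /glued; case: pselect => // -[i []]. Qed.

(** Inside the domain the equation is local. At a point of the physical boundary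
    the finitely many local solutions that come near it all tend to 0. *)
Lemma glued_solution : (0 < N)%N ->
  dirichlet_solution A Om (fun=> 0) (fun=> 0) glued.
Proof.
move=> N0.
have C2 i : C2_on (psi i) glued.
  by have [c _ _ _] := vP i; apply: C2_on_eq c => // y; exact: gluedE.
split.
- split=> [x /(psi_cover N0)[i px]|j x /(psi_cover N0)[i px]|j k x /(psi_cover N0)[i px]];
  by have [h0 h1 h2] := C2 i; auto.
- apply/within_contP => x cx e e0.
  have [Ox|Ox] := pselect (Om x).
    have [i px] := psi_cover N0 Ox.
    have [h0 _ _] := C2 i; have := h0 x px.
    by move=> /cvgrPdist_le/(_ e e0); apply: filterS.
  have near_i i : \forall y \near x, psi i y -> `|v i y| <= e.
    have [cix|cix] := pselect (closure (psi i) x); last first.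
      have : \forall y \near x, (~` closure (psi i)) y.
        by apply: open_nbhs_nbhs; split=> //; exact/closed_openC/closed_closure.
      by apply: filterS => y ny /subset_closure.
    have [_ cv _ _] := vP i.
    have := (within_contP _ _).1 cv x cix e e0; apply: filterS => y H py.
    have := H (subset_closure py); rewrite v_physical// sub0r normrN; exact.
  have : \forall y \near x, forall i, psi i y -> `|v i y| <= e.
    exact: (@filter_forall _ _ _ _ (nbhs_filter x) near_i).
  apply: filterS => y H _; rewrite glued_out// sub0r normrN.
  have [Oy|Oy] := pselect (Om y); last by rewrite glued_out// normr0 ltW.
  by have [i py] := psi_cover N0 Oy; rewrite (gluedE py); exact: H.
- move=> x /(psi_cover N0)[i px]; have [_ _ eq_ _] := vP i.
  by rewrite (diffop_app_eq A (@psi_open i) (@gluedE i) px) eq_.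
- by move=> x; rewrite boundary_open// => -[_ Ox]; exact: glued_out.
Qed.

Lemma fixpoint_glued i x : E i x -> Om x -> w i x = glued x.
Proof.
move=> Ex Ox; rewrite -v_central//; apply/esym/gluedE.
split=> //=; rewrite (interface_height Ex) !(level_lt P_slabs).
by rewrite !ltnSn.
Qed.

End extension.

Lemma fixpoint_zero : uniquely_solvable A Om (fun=> 0) (fun=> 0) ->
  forall i x, E i x -> w i x = 0.
Proof.
move=> [z _ zu] i x Ex; have N0 : (0 < N)%N by apply: leq_ltn_trans (ltn_ord i).
have [Ox|Ox] := pselect (Om x); last exact: fixpoint_vanishes.
have [v vP] := local_solution.
rewrite (fixpoint_glued vP Ex Ox) (zu _ (glued_solution vP N0)); last exact: subset_closure.
by rewrite -(zu _ (dirichlet_solution0 A Om))//; exact: subset_closure.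
Qed.

End gluing.

(** * Injectivity and conclusion *)

Section injectivity.
Context (R : realType) (d : nat) (P : slabs R d) (A : diffop R d).
Hypothesis d0 : (0 < d)%N.
Hypothesis P_slabs : slab_decomposition P.
Context (G : nat -> 'rV[R]_d -> 'rV[R]_d -> R).
Hypothesis single_solvable : forall k, (k <= nds P)%N ->
  local_uniquely_solvable A (single_slab P k).
Hypothesis double_solvable : forall k, (0 < k <= nds P)%N ->
  local_uniquely_solvable A (double_slab P k).
Hypothesis G_poisson : forall k, (0 < k <= nds P)%N ->
  poisson_kernel A (double_slab P k) (G k).
Hypothesis G_regular : forall k, (0 < k <= nds P)%N ->
  continuous_off_diagonal (double_slab P k) (G k).

(** A fixed point [u] is replaced by [K u], which differs from it by norm zero
    and satisfies the equation at every point of the interfaces, because the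
    kernel only sees [u] up to norm zero. *)
Lemma equilibrium_injective :
  uniquely_solvable A (domain P) (fun=> 0) (fun=> 0) ->
  forall u, L2_sum P u -> nrm (L2_dot P) (u - equilibrium_K P G u) = 0 ->
  nrm (L2_dot P) u = 0.
Proof.
move=> uniq u Xu uK; have S := @L2_sum_semi_inner R d P.
have KP := (equilibrium_compact d0 P_slabs G_regular).1.
set w := equilibrium_K P G u in uK; have Xw : L2_sum P w := op_mem KP Xu.
have w_fix (i : 'I_(nds P)) x : interface P i.+1 x -> w i x = equilibrium_K P G w i x.
  move=> Ex; have Xk := kernel_family_mem d0 P_slabs G_regular Ex.
  have := dot_null S (memB S Xu Xw) Xk uK.
  rewrite (dotDl S)//; last exact: (memN S).
  rewrite (dotNl S)// => /subr0_eq uw.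
  by rewrite {1}/w !equilibrium_KE (dotsC S _ _ Xk Xu) uw (dotsC S _ _ Xk Xw).
have w0 := fixpoint_zero d0 P_slabs single_solvable double_solvable G_poisson
  G_regular Xw w_fix uniq.
have w_null : eqv (L2_dot P) w 0.
  apply: (@eqv_families _ _ R (surface R d) (nds P) (fun i => interface P i.+1)) => i.
    exact/closed_surface_measurable/interface_closed.
  by move=> x Ex; rewrite w0.
by rewrite (eqv_nrm S Xu Xw uK); move: w_null; rewrite /eqv subr0.
Qed.

End injectivity.

Theorem proposition3p1 (R : realType) (d : nat) (d23 : d = 2%N \/ d = 3%N)
    (P : slabs R d) (P_slabs : slab_decomposition P)
    (A : diffop R d) (A_elliptic : elliptic A (domain P))
    (f g : 'rV[R]_d -> R)
    (global_solvable : uniquely_solvable A (domain P) f g)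
    (single_solvable : forall k, (k <= nds P)%N ->
      local_uniquely_solvable A (single_slab P k))
    (double_solvable : forall k, (0 < k <= nds P)%N ->
      local_uniquely_solvable A (double_slab P k))
    (G : nat -> 'rV[R]_d -> 'rV[R]_d -> R)
    (G_poisson : forall k, (0 < k <= nds P)%N ->
      poisson_kernel A (double_slab P k) (G k))
    (G_regular : forall k, (0 < k <= nds P)%N ->
      continuous_off_diagonal (double_slab P k) (G k)) :
  [/\ hilbert_schmidt (L2_sum P) (L2_dot P) (equilibrium_K P G),
      compact_operator (L2_sum P) (L2_dot P) (equilibrium_K P G),
      fredholm_index (L2_sum P) (L2_dot P) (equilibrium_S P G) 0
    & uniquely_solvable A (domain P) (fun=> 0) (fun=> 0) ->
      invertible_operator (L2_sum P) (L2_dot P) (equilibrium_S P G)].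
Proof.
have d0 : (0 < d)%N by case: d23 => ->.
have S := @L2_sum_semi_inner R d P.
have Kcompact := equilibrium_compact d0 P_slabs G_regular.
split; [exact: equilibrium_hilbert_schmidt|by []|exact: (fredholm_compact S)|].
move=> uniq; apply: (compact_invertible S Kcompact).
exact: (equilibrium_injective d0 P_slabs single_solvable double_solvable
  G_poisson G_regular uniq).
Qed.
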